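(* Let $C:f=0$ be a reduced plane curve of degree $d$ in $\mathbb{P}^2$ which is not a union of lines passing through one point. If $C$ is nearly free, then the minimal graded free resolution of the Milnor algebra $M(f)$ over $S$ has the form $$0 \to S(-b-2(d-1)) \to \bigoplus_{i=1}^{3}S(-d_i-(d-1)) \to S^3(-d+1) \to S,$$ for some integers $1 \leq d_1\leq d_2 \leq d_3$ and $b$.
   Context: $S=\mathbb{C}[x,y,z]$ with its standard grading, $f\in S$ is homogeneous of degree $d$, and $C\subset\mathbb{P}^2$ is the complex projective plane curve $f=0$. $J_f=(f_x,f_y,f_z)\subset S$ is the Jacobian ideal, generated by the partial derivatives of $f$; $M(f)=S/J_f$ is the (graded) Milnor algebra; $I_f$ is the saturation of $J_f$ with respect to the maximal ideal $\mathbf{m}=(x,y,z)$; and $N(f)=I_f/J_f=H^0_{\mathbf m}(M(f))$, a graded $S$-module with homogeneous components $N(f)_k$. The reduced curve $C$ is called nearly free if $N(f)\neq 0$ and $\dim_{\mathbb{C}} N(f)_k\leq 1$ for every integer $k$. *)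

(* Defs.v *)
From HB Require Import structures.
From mathcomp Require Import all_boot all_order all_algebra ring_quotient.
From mathcomp Require Import boolp complex mpoly.

Set Implicit Arguments.
Unset Strict Implicit.
Unset Printing Implicit Defensive.

Import GRing.Theory.
Local Open Scope ring_scope.
Local Open Scope quotient_scope.

Notation poly3 K := {mpoly K[3]}.

Section Ideals.
Variable K : fieldType.
Implicit Types (f p : poly3 K) (k : int).

(* p lies in S_k, with S_k = 0 for k < 0; note that 0 is n.-homog for all n. *)
Definition zhomog k p : bool :=
  if k is Posz n then p \is n.-homog else p == 0.

Definition in_ideal3 (g : 'I_3 -> poly3 K) p : Prop :=
  exists a : 'I_3 -> poly3 K, p = \sum_i a i * g i.

Definition in_irrelevant p : Prop := in_ideal3 (fun i => 'X_i) p.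

Definition jacobian f : pred (poly3 K) :=
  fun p => `[< in_ideal3 (fun i => f^`M(i)) p >].

(* p lies in the saturation iff m^k p is contained in J_f for some k; the
   monomials of degree k generate m^k. *)
Definition in_saturation f p : Prop :=
  exists k : nat, forall t : 'X_{1..3}, mdeg t = k -> 'X_[t] * p \in jacobian f.

Lemma jacobian_zmod_closed f : zmod_closed (jacobian f).
Proof.
split=> [|p q /asboolP[a ->] /asboolP[b ->]]; apply/asboolP.
  by exists (fun=> 0); rewrite big1 // => i _; rewrite mul0r.
exists (fun i => a i - b i); rewrite -sumrB.
by apply: eq_bigr => i _; rewrite mulrBl.
Qed.

HB.instance Definition _ f :=
  GRing.isZmodClosed.Build (poly3 K) (jacobian f) (jacobian_zmod_closed f).

Definition jacobian_closed f : zmodClosed (poly3 K) :=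
  GRing.ZmodClosed.clone _ (jacobian f) _.

Lemma jacobianMl f a p : p \in jacobian f -> a * p \in jacobian f.
Proof.
move=> /asboolP[b ->]; apply/asboolP; exists (fun i => a * b i).
by rewrite mulr_sumr; apply: eq_bigr => i _; rewrite mulrA.
Qed.

Definition milnor f : Type := Quotient.quot (jacobian_closed f).

HB.instance Definition _ f := GRing.Zmodule.on (milnor f).

Definition milnor_pi f p : milnor f := \pi_(Quotient.quot (jacobian_closed f)) p.

Definition milnor_scale f (a : poly3 K) (v : milnor f) : milnor f :=
  milnor_pi f (a * repr (v : Quotient.quot (jacobian_closed f))).

Lemma milnor_piP f p q :
  (milnor_pi f p = milnor_pi f q) <-> (p - q \in jacobian f).
Proof. by rewrite Quotient.idealrBE; split=> [/eqP|/eqP]. Qed.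

Lemma milnor_piB f p q :
  milnor_pi f (p - q) = milnor_pi f p - milnor_pi f q.
Proof. exact: (raddfB (\pi_(Quotient.quot (jacobian_closed f)))). Qed.

Lemma milnor_piD f p q :
  milnor_pi f (p + q) = milnor_pi f p + milnor_pi f q.
Proof. exact: (raddfD (\pi_(Quotient.quot (jacobian_closed f)))). Qed.

Lemma milnor_reprK f (v : milnor f) :
  milnor_pi f (repr (v : Quotient.quot (jacobian_closed f))) = v.
Proof. exact: reprK. Qed.

Lemma milnor_scale_pi f a p :
  milnor_scale a (milnor_pi f p) = milnor_pi f (a * p).
Proof.
by apply/milnor_piP; rewrite -mulrBr jacobianMl //; apply/milnor_piP/milnor_reprK.
Qed.

Fact milnor_scaleA f a b (v : milnor f) :
  milnor_scale a (milnor_scale b v) = milnor_scale (a * b) v.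
Proof. by rewrite -(milnor_reprK v) !milnor_scale_pi mulrA. Qed.

Fact milnor_scale1 f : left_id 1 (@milnor_scale f).
Proof. by move=> v; rewrite -(milnor_reprK v) milnor_scale_pi mul1r. Qed.

Fact milnor_scaleDr f : right_distributive (@milnor_scale f) +%R.
Proof.
move=> a u v; rewrite -(milnor_reprK u) -(milnor_reprK v).
by rewrite -milnor_piD !milnor_scale_pi mulrDr milnor_piD.
Qed.

Fact milnor_scaleDl f (v : milnor f) :
  {morph @milnor_scale f ^~ v : a b / a + b}.
Proof.
move=> a b; rewrite -(milnor_reprK v) !milnor_scale_pi.
by rewrite mulrDl milnor_piD.
Qed.

HB.instance Definition _ f :=
  GRing.Zmodule_isLmodule.Build (poly3 K) (milnor f)
    (@milnor_scaleA f) (@milnor_scale1 f) (@milnor_scaleDr f)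
    (@milnor_scaleDl f).

Definition milnor_deg f k (v : milnor f) : Prop :=
  exists2 p, zhomog k p & v = milnor_pi f p.

Definition in_N f (v : milnor f) : Prop :=
  exists2 p, in_saturation f p & v = milnor_pi f p.

Definition in_N_deg f k (v : milnor f) : Prop := in_N v /\ milnor_deg k v.

(* dim_K V <= n, for V a K-subspace of the S-module M. *)
Definition dim_le (M : lmodType (poly3 K)) (V : M -> Prop) (n : nat) : Prop :=
  exists2 e : 'I_n -> M, (forall i, V (e i)) &
    forall v, V v -> exists c : 'I_n -> K, v = \sum_i (c i)%:MP *: e i.

Definition nearly_free f : Prop :=
  (exists2 v : milnor f, in_N v & v <> 0) /\
  (forall k, dim_le (@in_N_deg f k) 1).

End Ideals.

Section Curves.
Variable K : fieldType.
Implicit Types f : poly3 K.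

(* f has no multiple factor; in particular f != 0. *)
Definition reduced f : Prop :=
  forall g h : poly3 K, f = g ^+ 2 * h -> exists c : K, g = c%:MP.

(* Points of P^2 are represented by their nonzero coordinate vectors, and a
   line by a nonzero linear form. *)
Definition concurrent_lines f : Prop :=
  exists (p : {ffun 'I_3 -> K}) (ls : seq (poly3 K)),
    [/\ p != 0,
        forall l, l \in ls -> [/\ l != 0, l \is 1.-homog & l.@[p] = 0]
      & forall q : {ffun 'I_3 -> K}, q != 0 ->
          (f.@[q] == 0) = has (fun l => l.@[q] == 0) ls].

End Curves.

Section Resolutions.
Variable K : fieldType.
Local Notation S := (poly3 K).

(* Degree k part of the graded free module (+)_i S(s_i), where
   S(s)_k = S_(s + k). *)
Definition free_deg n (s : n.-tuple int) (k : int) (u : 'rV[S]_n) : Prop :=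
  forall i, zhomog (tnth s i + k) (u 0 i).

Definition graded_map (M N : Type) (degM : int -> M -> Prop)
    (degN : int -> N -> Prop) (phi : M -> N) : Prop :=
  forall k v, degM k v -> degN k (phi v).

Definition exact_at (L M N : lmodType S) (phi : L -> M) (psi : M -> N) : Prop :=
  forall v, psi v = 0 <-> exists u, v = phi u.

Definition minimal_map (M : lmodType S) n (phi : M -> 'rV[S]_n) : Prop :=
  forall u i, in_irrelevant (phi u 0 i).

(* M, graded by degM, has a minimal graded free resolution
   0 -> F3 -> F2 -> F1 -> F0 -> M -> 0 with F_j = (+)_i S(s_j,i). *)
Definition has_minimal_graded_free_resolution
    (M : lmodType S) (degM : int -> M -> Prop)
    n3 n2 n1 n0 (s3 : n3.-tuple int) (s2 : n2.-tuple int)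
    (s1 : n1.-tuple int) (s0 : n0.-tuple int) : Prop :=
  exists (phi3 : {linear 'rV[S]_n3 -> 'rV[S]_n2})
         (phi2 : {linear 'rV[S]_n2 -> 'rV[S]_n1})
         (phi1 : {linear 'rV[S]_n1 -> 'rV[S]_n0})
         (eps : {linear 'rV[S]_n0 -> M}),
    [/\ [/\ graded_map (free_deg s3) (free_deg s2) phi3,
            graded_map (free_deg s2) (free_deg s1) phi2,
            graded_map (free_deg s1) (free_deg s0) phi1
          & graded_map (free_deg s0) degM eps],
        [/\ injective phi3, exact_at phi3 phi2, exact_at phi2 phi1,
            exact_at phi1 eps & forall v, exists u, v = eps u]
      & [/\ minimal_map phi3, minimal_map phi2 & minimal_map phi1]].

End Resolutions.

(* Main.v *)
Require Import Defs.
From mathcomp Require Import all_boot all_order all_algebra.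
From mathcomp Require Import complex reals mpoly.
From HB Require Import structures.
From mathcomp Require Import boolp ring zify.
Local Open Scope ring_scope.

Set Implicit Arguments.
Unset Strict Implicit.

Import GRing.Theory Num.Theory.

(** Let J be the ideal generated by three forms f_0, f_1, f_2 of degree e (in
    the end, the partial derivatives of f), I its saturation, N = I/J, m the
    irrelevant ideal and Syz the module of syzygies of the f_i, i.e. the rows s
    with [dot s = 0].  A minimal resolution of S/J of the required shape amounts
    to three homogeneous generators of Syz, of positive degree, with a single
    relation between them, whose coefficients lie in m.  The hypothesis is used
    in the form: each N_k has dimension at most 1, and N is not 0.

    Construction.  Let h span the component of least degree eta of N.  As
    N_(eta+1) has dimension at most 1, the map sending a linear form u to u h is,
    up to a factor, evaluation at some point q.  In coordinates l_0, l_1, l_2 with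
    q = (0 : 0 : 1) the forms l_0 and l_1 kill h, and h generates the chain
    h, l_2 h, ..., l_2^m h, whose last term lies in the socle of N.  Write l_0 h,
    l_1 h and l_2^(m+1) h as combinations of the f_i, with coefficient rows
    A, B, C.  The Koszul relations of (l_0, l_1, l_2^(m+1)) turn these rows into
    three syzygies [koszul_syz], bound by the relation with coefficients
    (l_0, l_1, l_2^(m+1)).  The claim is that they generate Syz.

    Two facts carry the proof.
    - The three syzygies are independent modulo m Syz ([kos_in_mSyz],
      [kos_descent]): this is the injectivity of
      Tor_2(N, K) -> Tor_2(S/J, K), which holds because the socle of S/I is 0.
    - Choose a second point p = (0 : 1 : 0) at which some f_i does not vanish.
      The values at p of all syzygies lie in the plane orthogonal to
      (f_0(p), f_1(p), f_2(p)).  A syzygy s that vanishes at p has the form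
      l_0 b - l_2 a, and yields n in N with l_0 n = l_2 n = 0; if n = 0 then s
      lies in m Syz ([syz_vanish_at], [syz_mod_forms]).

    Along the chain only its last term is killed by l_0 and l_2, and it
    corresponds to the syzygy number 1, up to sign.  Together with the
    independence modulo m Syz this shows that the values at p of the syzygies
    number 2 and 0 are not reached, even after adding multiples of the former,
    in lower degree ([kos2_jump], [kos0_jump]).  So these two values span the
    plane, and the plane is exhausted in all degrees beyond the chain.  Hence N
    has no socle beyond the chain: a socle element there would give three more
    Koszul syzygies, at least two of them independent modulo m Syz, while a
    single class is left once the plane is exhausted ([no_socle_above]).
    Subtracting from a syzygy the combination of the numbers 0 and 2 with the
    same value at p, one is left with a multiple of the number 1 modulo m Syz,
    and a graded Nakayama argument concludes ([kos_generate]).  The numbers 0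
    and 2 are linearly independent already at p, so the relations have rank 1
    and are the multiples of the known one ([kos_relations]).

    Minimality needs that the partial derivatives of f satisfy no linear
    relation with constant coefficients c.  Such a relation says that f is
    invariant under translation along c, so that its zero set is that of a
    binary form: a union of lines through c
    ([constant_syzygy_concurrent]). *)

(** * Substitutions and homogeneous components *)

Section Tools.
Variables (n : nat) (K : fieldType).
Local Notation S := {mpoly K[n]}.

Lemma mpoly_ring_ind (P : S -> Prop) :
  (forall c, P c%:MP) -> (forall i, P 'X_i) ->
  (forall g h, P g -> P h -> P (g + h)) ->
  (forall g h, P g -> P h -> P (g * h)) -> forall g, P g.
Proof.
move=> PC PX PD PM; apply: mpolyind => [|c m g _ _ Pg]; first by rewrite -mpolyC0.
apply: PD => //; rewrite -mul_mpolyC; apply: (PM) => //.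
have P1 : P 1 by rewrite -mpolyC1.
rewrite mpolyXE_id; apply: (@big_ind S P 1 *%R P1 PM) => i _.
by elim: (m i) => [|k IH]; rewrite ?expr0 ?exprS //; apply: (PM).
Qed.

(** Modulo the ideal of the 'X_i - w_i, substituting w for the variables changes
    nothing.  All divisibility statements about linear forms below come from
    this congruence. *)
Lemma comp_mpoly_congr (w : n.-tuple S) (g : S) :
  exists a : 'I_n -> S, g - (g \mPo w) = \sum_i a i * ('X_i - tnth w i).
Proof.
elim/mpoly_ring_ind: g => [c|i|g h [a Ea] [b Eb]|g h [a Ea] [b Eb]].
- by exists (fun=> 0); rewrite comp_mpolyC subrr big1 // => i _; rewrite mul0r.
- exists (fun j => (j == i)%:R); rewrite comp_mpolyXU -tnth_nth.
  rewrite (bigD1 i) //= eqxx mul1r big1 ?addr0 // => j /negbTE->.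
  by rewrite mul0r.
- exists (fun i => a i + b i).
  under eq_bigr do rewrite mulrDl.
  by rewrite big_split /= -Ea -Eb comp_mpolyD; ring.
- exists (fun i => a i * h + (g \mPo w) * b i).
  transitivity ((g - (g \mPo w)) * h + (g \mPo w) * (h - (h \mPo w))).
    by rewrite rmorphM /=; ring.
  rewrite Ea Eb mulr_suml mulr_sumr -big_split; apply: eq_bigr => i _ /=.
  ring.
Qed.

Lemma pihomogM (d k : nat) (g h : S) : g \is d.-homog ->
  pihomog mdeg (d + k) (g * h) = g * pihomog mdeg k h.
Proof.
move=> hg; rewrite [h]mpolyE mulr_sumr !linear_sum mulr_sumr /=.
apply: eq_bigr => m _; rewrite -scalerAr !linearZ /= -scalerAr; congr (_ *: _).
have hgm : g * 'X_[m] \is (d + mdeg m).-homog by apply: dhomogM; rewrite ?dhomogX.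
have [<-|ne] := eqVneq (mdeg m) k.
  by rewrite !pihomog_dE // dhomogX.
rewrite (pihomog_ne0 (p := 'X_[m]) ne) ?dhomogX // mulr0.
by rewrite (pihomog_ne0 _ hgm) // eqn_add2l.
Qed.

Lemma dhomogC (c : K) : (c%:MP : S) \is 0.-homog.
Proof. by rewrite -[c%:MP]mulr1 mul_mpolyC; apply/dhomogZ/dhomog1. Qed.

Lemma dhomogCM k c (g : S) : g \is k.-homog -> c%:MP * g \is k.-homog.
Proof. by move=> hg; rewrite mul_mpolyC; apply: dhomogZ. Qed.

Lemma meval_dhomog0 v (g : S) : g \is 0.-homog -> g = (g.@[v])%:MP.
Proof.
move=> hg.
have gE : g = (g@_0)%:MP.
  apply/mpolyP => m; rewrite mcoeffC; have [->|m0] := eqVneq m 0%MM.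
    by rewrite mulr1.
  rewrite mulr0; apply: (dhomog_nemf_coeff hg).
  by rewrite mdeg_eq0.
by rewrite gE mevalC.
Qed.

(** Reduction modulo the ideal of a point v of projective space: on homogeneous
    polynomials it is evaluation at v, up to a power of l. *)
Lemma comp_mpoly_line k (g : S) (v : 'I_n -> K) (l : S) : g \is k.-homog ->
  g \mPo [tuple (v i)%:MP * l | i < n] = (g.@[v])%:MP * l ^+ k.
Proof.
move=> /dhomogP hg; rewrite comp_mpolyEX mevalE rmorph_sum /= mulr_suml.
rewrite !big_seq; apply: eq_bigr => m mg.
rewrite comp_mpolyX -mul_mpolyC rmorphM /= -mulrA; congr (_ * _).
under eq_bigr do rewrite tnth_mktuple exprMn.
rewrite big_split /= -expr_sum -mdegE hg // rmorph_prod; congr (_ * _).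
by apply: eq_bigr => i _; rewrite rmorphXn.
Qed.

Lemma pihomogM_lt (d k : nat) (g h : S) : g \is d.-homog -> (k < d)%N ->
  pihomog mdeg k (g * h) = 0.
Proof.
move=> hg kd; rewrite [h]mpolyE mulr_sumr linear_sum big1 //= => m _.
rewrite -scalerAr linearZ /= (@pihomog_ne0 _ _ _ (d + mdeg m)) ?scaler0 //.
  by rewrite neq_ltn orbC (leq_trans kd) ?leq_addr.
by apply: dhomogM; rewrite ?dhomogX.
Qed.

Lemma dhomog_divl (d k : nat) (g h : S) : g != 0 -> g \is d.-homog ->
  g * h \is (d + k).-homog -> h \is k.-homog.
Proof.
move=> g0 hg hgh; rewrite homog_piE; apply/eqP/(mulfI g0).
by rewrite -(pihomogM _ _ hg) pihomog_dE.
Qed.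

End Tools.

(** * Linear coordinates dual to three points *)

Lemma sum3E (V : nmodType) (F : 'I_3 -> V) : \sum_i F i = F 0 + F 1 + F 2.
Proof.
rewrite !big_ord_recl big_ord0 addr0 addrA.
by congr (F _ + F _ + F _); apply: val_inj.
Qed.

Lemma ord3P (i : 'I_3) : [\/ i = 0, i = 1 | i = 2].
Proof.
case: i => [[|[|[|//]]] Hi]; [apply: Or31|apply: Or32|apply: Or33]; exact: val_inj.
Qed.

Section DualForms.
Variables (K : fieldType) (P : 'M[K]_3).
Hypothesis P_unit : P \in unitmx.
Local Notation S := {mpoly K[3]}.

(** Coordinate forms of the basis of points given by the rows of P.  The points
    P 1 and P 2 are the p and q of the introduction. *)
Definition dual_form (j : 'I_3) : S := \sum_k (invmx P k j)%:MP * 'X_k.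
Local Notation l := dual_form.

Lemma dual_form_homog j : l j \is 1.-homog.
Proof.
by apply: rpred_sum => k _; apply: dhomogCM; rewrite dhomogX /= mdeg1.
Qed.

Lemma var_dual_form k : 'X_k = \sum_j (P j k)%:MP * l j.
Proof.
under eq_bigr do rewrite mulr_sumr.
rewrite exchange_big /=.
under eq_bigr do under eq_bigr do rewrite mulrA -rmorphM mulrC /=.
under eq_bigr do rewrite -mulr_sumr -rmorph_sum /=.
under eq_bigr => i _.
  rewrite (_ : \sum_j _ = (invmx P *m P) i k); last first.
    by rewrite mxE; apply: eq_bigr => j _; rewrite mulrC.
  rewrite mulVmx // mxE; over.
rewrite (bigD1 k) //= eqxx mulr1 big1 ?addr0 // => i /negbTE->.
by rewrite mulr0.
Qed.

Lemma dual_form_eval i j : (l j).@[P i] = (i == j)%:R.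
Proof.
rewrite raddf_sum /= -[RHS]/(nat_of_bool _)%:R.
transitivity ((P *m invmx P) i j); last by rewrite mulmxV // mxE.
rewrite mxE; apply: eq_bigr => k _.
by rewrite mevalM mevalC mevalXU mulrC.
Qed.

(** The substitution that projects onto the span of the P j with j outside A. *)
Definition kill_forms (A : pred 'I_3) : 3.-tuple S :=
  [tuple \sum_(j | ~~ A j) (P j k)%:MP * l j | k < 3].

Lemma kill_form A j : l j \mPo kill_forms A = if A j then 0 else l j.
Proof.
rewrite {1}/dual_form raddf_sum /=.
under eq_bigr => k _.
  rewrite rmorphM /= comp_mpolyC comp_mpolyXU -tnth_nth tnth_mktuple mulr_sumr.
  under eq_bigr do rewrite mulrA -rmorphM mulrC /=.
  over.
rewrite exchange_big /=.
under eq_bigr => i _.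
  rewrite -mulr_sumr -rmorph_sum /=.
  rewrite (_ : \sum_k _ = (P *m invmx P) i j); last first.
    by rewrite mxE; apply: eq_bigr => k _; rewrite mulrC.
  rewrite mulmxV // mxE; over.
case: ifP => Aj.
  rewrite big1 // => i; case: eqP => [->|_]; first by rewrite Aj.
  by rewrite mulr0.
rewrite (bigD1 j) ?Aj //= eqxx mulr1 big1 ?addr0 // => i /andP[_ /negbTE->].
by rewrite mulr0.
Qed.

Lemma kill_congr A (g : S) :
  exists c : 'I_3 -> S, g - (g \mPo kill_forms A) = \sum_(j | A j) l j * c j.
Proof.
have [a ->] := comp_mpoly_congr (kill_forms A) g.
exists (fun j => \sum_i a i * (P j i)%:MP).
under [RHS]eq_bigr do rewrite mulr_sumr.
rewrite exchange_big; apply: eq_bigr => k _ /=.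
rewrite tnth_mktuple {1}var_dual_form (bigID A) /= addrK mulr_sumr.
by apply: eq_bigr => j _; ring.
Qed.

Lemma dual_form_neq0 j : l j != 0.
Proof.
apply/eqP => lj0; have := dual_form_eval j j.
by rewrite lj0 meval0 eqxx => /eqP; rewrite eq_sym oner_eq0.
Qed.

(** Setting l j to zero is an endomorphism of the domain S that fixes l i, so l j
    divides u. *)
Lemma dual_form_regular i j (u v : S) : i != j -> l i * u = l j * v ->
  exists2 n, u = l j * n & v = l i * n.
Proof.
move=> ij uv; have [c Ec] := kill_congr (pred1 j) u.
have u0 : u \mPo kill_forms (pred1 j) = 0.
  have /(congr1 (comp_mpoly (kill_forms (pred1 j)))) := uv.
  rewrite !rmorphM /= !kill_form /= eqxx (negbTE ij) mul0r => /eqP.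
  by rewrite mulf_eq0 (negbTE (dual_form_neq0 i)) => /eqP.
move: Ec; rewrite u0 subr0 big_pred1_eq => Eu; exists (c j) => //.
apply: (mulfI (dual_form_neq0 j)); rewrite -uv Eu; ring.
Qed.

(** Exactness of the Koszul complex of l 0, l 1, l 2 in the middle: setting l 0
    and l 1 to zero gives a2 in the ideal (l 0, l 1), and what remains is a
    relation between l 0 and l 1. *)
Lemma dual_form_koszul (a0 a1 a2 : S) : l 0 * a0 + l 1 * a1 + l 2 * a2 = 0 ->
  exists v0 v1 v2, [/\ a0 = l 1 * v2 - l 2 * v1, a1 = l 2 * v0 - l 0 * v2
    & a2 = l 0 * v1 - l 1 * v0].
Proof.
move=> E; pose A := [pred i : 'I_3 | i != 2].
have [c Ec] := kill_congr A a2.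
have a20 : a2 \mPo kill_forms A = 0.
  have /(congr1 (comp_mpoly (kill_forms A))) := E.
  rewrite !rmorphD !rmorphM /= !kill_form /= rmorph0 !mul0r !add0r => /eqP.
  by rewrite mulf_eq0 (negbTE (dual_form_neq0 _)) => /eqP.
move: Ec; rewrite a20 subr0 big_mkcond sum3E /= addr0 => Ea2.
have [//||v2 E1 E0] := @dual_form_regular 1 0 (a1 + l 2 * c 1) (- (a0 + l 2 * c 0)).
- by apply/eqP; rewrite -subr_eq0 -E Ea2; apply/eqP; ring.
exists (- c 1), (c 0), (- v2); split.
- by rewrite -[a0](addrK (l 2 * c 0)) -[a0 + _]opprK E0; ring.
- by rewrite -[a1](addrK (l 2 * c 1)) E1; ring.
- by rewrite Ea2; ring.
Qed.

(** Homogeneous polynomials vanishing at P 1 form the ideal of this point, which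
    l 0 and l 2 generate. *)
Lemma dual_form_split k (g : S) : g \is k.+1.-homog ->
  exists a b, [/\ a \is k.-homog, b \is k.-homog &
    g = (g.@[P 1])%:MP * l 1 ^+ k.+1 + l 0 * a + l 2 * b].
Proof.
move=> hg; pose A := [pred i : 'I_3 | i != 1].
have [c Ec] := kill_congr A g.
exists (pihomog mdeg k (c 0)), (pihomog mdeg k (c 2)).
split; [exact: pihomogP | exact: pihomogP |].
have killE : kill_forms A = [tuple (P 1 i)%:MP * l 1 | i < 3].
  apply: eq_from_tnth => i; rewrite !tnth_mktuple big_mkcond sum3E /=.
  by rewrite add0r addr0.
move: Ec; rewrite killE (comp_mpoly_line _ _ hg).
rewrite big_mkcond sum3E /= addr0 => Ec.
have hl j := dual_form_homog j.
rewrite -!(pihomogM _ _ (hl _)) !add1n -addrA -pihomogD -Ec pihomogB.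
rewrite (pihomog_dE hg) pihomog_dE; first by rewrite addrC subrK.
by apply: dhomogCM; have := dhomogMn k.+1 (hl 1); rewrite mul1n.
Qed.

End DualForms.

(** * Row vectors, the ideal J and its saturation *)

Section RowEntries.
Variables (R : pzRingType) (n : nat) (a b : 'rV[R]_n) (i : 'I_n) (x y : R).
Hypotheses (Ea : a 0 i = x) (Eb : b 0 i = y).

Lemma row_entryD : (a + b) 0 i = x + y. Proof. by rewrite mxE Ea Eb. Qed.
Lemma row_entryN : (- a) 0 i = - x. Proof. by rewrite mxE Ea. Qed.
Lemma row_entryZ c : (c *: a) 0 i = c * x. Proof. by rewrite mxE Ea. Qed.
Lemma row_entry0 : (0 : 'rV[R]_n) 0 i = 0. Proof. by rewrite mxE. Qed.

End RowEntries.

(** The entries of a linear combination of rows are read off its syntax, so that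
    the rows in it are never unfolded. *)
Ltac row_entry s i :=
  lazymatch s with
  | @GRing.add _ ?a ?b =>
    let p := row_entry a i in let q := row_entry b i in
    constr:(@row_entryD _ _ a b i _ _ p q)
  | @GRing.opp _ ?a =>
    let p := row_entry a i in constr:(@row_entryN _ _ a i _ p)
  | @GRing.scale _ _ ?c ?a =>
    let p := row_entry a i in constr:(@row_entryZ _ _ a i _ p c)
  | @GRing.zero _ => constr:(@row_entry0 _ _ i : fun_of_matrix s ord0 i = _)
  | _ => constr:(erefl (fun_of_matrix s ord0 i))
  end.

Ltac row_ring :=
  let i := fresh "i" in
  apply/rowP => i;
  lazymatch goal with |- fun_of_matrix ?s _ _ = fun_of_matrix ?t _ _ =>
    let p := row_entry s i in let q := row_entry t i in
    refine (etrans p (etrans _ (esym q))); ring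
  end.

Section Syzygies.
Variables (K : fieldType) (f : 'I_3 -> {mpoly K[3]}) (e : nat).
Local Notation S := {mpoly K[3]}.
Hypothesis f_homog : forall i, f i \is e.-homog.
Local Notation inJ := (in_ideal3 f).

Definition dot (a : 'rV[S]_3) : S := \sum_i a 0 i * f i.

Lemma dotD a b : dot (a + b) = dot a + dot b.
Proof. by rewrite -big_split; apply: eq_bigr => i _; rewrite mxE mulrDl. Qed.

Lemma dotZ c a : dot (c *: a) = c * dot a.
Proof. by rewrite mulr_sumr; apply: eq_bigr => i _; rewrite mxE mulrA. Qed.

Lemma dotN a : dot (- a) = - dot a.
Proof. by rewrite -scaleN1r dotZ mulN1r. Qed.

Lemma dotB a b : dot (a - b) = dot a - dot b.
Proof. by rewrite dotD dotN. Qed.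

Lemma inJP u : inJ u <-> exists a, u = dot a.
Proof.
split=> [[a ->]|[a ->]]; last by exists (a 0).
by exists (\row_i a i); apply: eq_bigr => i _; rewrite mxE.
Qed.

Lemma inJ_dot a : inJ (dot a). Proof. by apply/inJP; exists a. Qed.

Lemma inJ0 : inJ 0.
Proof. by exists (fun=> 0); rewrite big1 // => i _; rewrite mul0r. Qed.

Lemma inJD u v : inJ u -> inJ v -> inJ (u + v).
Proof.
by move=> /inJP[a ->] /inJP[b ->]; apply/inJP; exists (a + b); rewrite dotD.
Qed.

Lemma inJM c u : inJ u -> inJ (c * u).
Proof. by move=> /inJP[a ->]; apply/inJP; exists (c *: a); rewrite dotZ. Qed.

Lemma inJN u : inJ u -> inJ (- u).
Proof. by move=> /(inJM (-1)); rewrite mulN1r. Qed.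

Lemma inJB u v : inJ u -> inJ v -> inJ (u - v).
Proof. by move=> Ju Jv; apply: inJD => //; apply: inJN. Qed.

Lemma inJ_addl u v : inJ u -> inJ (u + v) -> inJ v.
Proof. by move=> Ju Juv; have := inJB Juv Ju; rewrite addrAC subrr add0r. Qed.

Lemma inJ_gen i : inJ (f i).
Proof.
exists (fun j => (j == i)%:R); rewrite (bigD1 i) //= eqxx mul1r big1 ?addr0 //.
by move=> j /negbTE->; rewrite mul0r.
Qed.

Lemma inJC (c : K) u : c != 0 -> inJ (c%:MP * u) -> inJ u.
Proof.
by move=> c0 /(inJM (c^-1)%:MP); rewrite mulrA -rmorphM /= mulVf // mul1r.
Qed.

Definition vhom k (s : 'rV[S]_3) : Prop := forall i, s 0 i \is k.-homog.

Lemma vhomD k s t : vhom k s -> vhom k t -> vhom k (s + t).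
Proof. by move=> hs ht i; rewrite mxE rpredD. Qed.

Lemma vhomB k s t : vhom k s -> vhom k t -> vhom k (s - t).
Proof. by move=> hs ht i; rewrite !mxE rpredB. Qed.

Lemma vhomZ d k c s : c \is d.-homog -> vhom k s -> vhom (d + k) (c *: s).
Proof. by move=> hc hs i; rewrite mxE dhomogM. Qed.

Lemma vhom0 k : vhom k 0.
Proof. by move=> i; rewrite mxE rpred0. Qed.

Definition vpi k (s : 'rV[S]_3) := map_mx (pihomog mdeg k) s.

Lemma vpi_hom k s : vhom k (vpi k s).
Proof. by move=> i; rewrite mxE pihomogP. Qed.

(** As the f i are homogeneous, taking homogeneous components commutes with
    [dot]: J and Syz are graded. *)
Lemma pihomog_dot k a : pihomog mdeg (e + k) (dot a) = dot (vpi k a).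
Proof.
rewrite linear_sum /=; apply: eq_bigr => i _.
by rewrite mulrC (pihomogM _ _ (f_homog i)) mxE mulrC.
Qed.

Lemma pihomog_dot_lt k a : (k < e)%N -> pihomog mdeg k (dot a) = 0.
Proof.
move=> ke; rewrite linear_sum big1 //= => i _.
by rewrite mulrC (pihomogM_lt _ (f_homog i)).
Qed.

Lemma inJ_pihomog k u : inJ u -> inJ (pihomog mdeg k u).
Proof.
move=> /inJP[a ->]; have [ke|ek] := ltnP k e.
  by rewrite pihomog_dot_lt //; apply: inJ0.
by rewrite -(subnKC ek) pihomog_dot; apply: inJ_dot.
Qed.

Lemma inJ_homog k u : u \is (e + k).-homog -> inJ u ->
  exists2 a, vhom k a & u = dot a.
Proof.
move=> hu /inJP[a Eu]; exists (vpi k a); first exact: vpi_hom.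
by rewrite -pihomog_dot -Eu pihomog_dE.
Qed.

Lemma inJ_lt k u : (k < e)%N -> u \is k.-homog -> inJ u -> u = 0.
Proof.
by move=> ke hu /inJP[a Eu]; rewrite -(pihomog_dE hu) Eu pihomog_dot_lt.
Qed.

Lemma dot_homog k a : vhom k a -> dot a \is (k + e).-homog.
Proof. by move=> ha; apply: rpred_sum => i _; apply: dhomogM. Qed.

Lemma syz_pihomog k s : dot s = 0 -> dot (vpi k s) = 0.
Proof. by move=> s0; rewrite -pihomog_dot s0 raddf0. Qed.

(** Quantifying over all forms of degree k, instead of monomials only, makes the
    definition independent of coordinates. *)
Definition in_sat u := exists k, forall g : S, g \is k.-homog -> inJ (g * u).

Lemma inJ_in_sat u : inJ u -> in_sat u.
Proof. by move=> Ju; exists 0%N => g _; apply: inJM. Qed.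

Lemma in_sat_pihomog k u : in_sat u -> in_sat (pihomog mdeg k u).
Proof.
move=> [j Hj]; exists j => g hg.
by rewrite -(pihomogM _ _ hg); apply/inJ_pihomog/Hj.
Qed.

Lemma in_satM c u : in_sat u -> in_sat (c * u).
Proof. by move=> [j Hj]; exists j => g hg; rewrite mulrCA; apply/inJM/Hj. Qed.

Definition ev (v : 'I_3 -> K) (s : 'rV[S]_3) : 'rV[K]_3 := map_mx (meval v) s.

Lemma evD v s t : ev v (s + t) = ev v s + ev v t.
Proof. exact: raddfD. Qed.

Lemma evB v s t : ev v (s - t) = ev v s - ev v t.
Proof. exact: raddfB. Qed.

Lemma evZ v c s : ev v (c *: s) = c.@[v] *: ev v s.
Proof. exact: map_mxZ. Qed.

Variable P : 'M[K]_3.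
Hypothesis P_unit : P \in unitmx.
Local Notation l := (dual_form P).
Local Notation p := (P 1).
Local Notation evp := (ev p).

Lemma dual_form_exp_homog j k : l j ^+ k \is k.-homog.
Proof. by have := dhomogMn k (dual_form_homog P j); rewrite mul1n. Qed.

Lemma in_sat_mono k u : (forall g : S, g \is k.-homog -> inJ (g * u)) ->
  forall i (g : S), g \is (i + k).-homog -> inJ (g * u).
Proof.
move=> Hk; elim=> [//|i IH] g hg.
have [a [b [ha hb ->]]] := dual_form_split P_unit hg.
rewrite (_ : _ * u = l 1 * (((g.@[p])%:MP * l 1 ^+ (i + k)) * u)
  + l 0 * (a * u) + l 2 * (b * u)); last by rewrite exprS; ring.
by do 2?apply: inJD; apply/inJM/IH => //; apply/dhomogCM/dual_form_exp_homog.
Qed.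

Lemma in_satD u v : in_sat u -> in_sat v -> in_sat (u + v).
Proof.
move=> [i Hi] [j Hj]; exists (i + j)%N => g hg; rewrite mulrDr.
by apply: inJD; [apply: (in_sat_mono Hi (i := j)); rewrite addnC | apply: (in_sat_mono Hj hg)].
Qed.

(** Saturating twice adds nothing, and the l i generate the irrelevant ideal. *)
Lemma in_sat_forms u : (forall i, in_sat (l i * u)) -> in_sat u.
Proof.
move=> Hl; have [k0 H0] := Hl 0; have [k1 H1] := Hl 1; have [k2 H2] := Hl 2.
exists (k0 + k1 + k2).+1 => g hg.
have [a [b [ha hb ->]]] := dual_form_split P_unit hg.
rewrite (_ : _ * u = ((g.@[p])%:MP * l 1 ^+ (k0 + k1 + k2)) * (l 1 * u)
  + a * (l 0 * u) + b * (l 2 * u)); last by rewrite exprS; ring.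
apply: inJD; first apply: inJD.
- apply: (in_sat_mono H1 (i := k0 + k2)); rewrite addnAC.
  exact/dhomogCM/dual_form_exp_homog.
- by apply: (in_sat_mono H0 (i := k1 + k2)); rewrite addnC addnA.
- exact: (in_sat_mono H2 (i := k0 + k1)).
Qed.

End Syzygies.

(** * Koszul syzygies *)

(** With A, B, C the coefficient rows of l 0 h, l 1 h and l 2 ^+ m.+1 h, these
    are the syzygies that come from the Koszul relations of (l 0, l 1,
    l 2 ^+ m.+1).  Locking keeps their entries
    atomic in identities between rows. *)
HB.lock Definition koszul_syz (K : fieldType) (P : 'M[K]_3) (m : nat)
    (A B C : 'rV[{mpoly K[3]}]_3) (i : 'I_3) : 'rV[{mpoly K[3]}]_3 :=
  let l := dual_form P in
  if i == 0 then l 1 *: C - l 2 ^+ m.+1 *: B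
  else if i == 1 then l 2 ^+ m.+1 *: A - l 0 *: C else l 0 *: B - l 1 *: A.

Section KoszulSyzygies.
Variables (K : fieldType) (f : 'I_3 -> {mpoly K[3]}) (e : nat).
Hypothesis f_homog : forall i, f i \is e.-homog.
Variable P : 'M[K]_3.
Hypothesis P_unit : P \in unitmx.
Local Notation S := {mpoly K[3]}.
Local Notation l := (dual_form P).
Local Notation p := (P 1).
Local Notation evp := (ev p).
Local Notation dot := (dot f).
Local Notation inJ := (in_ideal3 f).
Local Notation in_sat := (in_sat f).

(** The submodule m Syz, m being generated by the linear forms l i. *)
Definition in_mSyz (s : 'rV[S]_3) : Prop :=
  exists s0 s1 s2, [/\ dot s0 = 0, dot s1 = 0, dot s2 = 0
    & s = l 0 *: s0 + l 1 *: s1 + l 2 *: s2].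

Lemma dot0 : dot 0 = 0.
Proof. by rewrite -(scale0r 0) dotZ mul0r. Qed.

Lemma in_mSyzD s t : in_mSyz s -> in_mSyz t -> in_mSyz (s + t).
Proof.
move=> [s0 [s1 [s2 [S0 S1 S2 ->]]]] [t0 [t1 [t2 [T0 T1 T2 ->]]]].
exists (s0 + t0), (s1 + t1), (s2 + t2).
by split; rewrite ?dotD ?S0 ?S1 ?S2 ?T0 ?T1 ?T2 ?addr0 //; row_ring.
Qed.

Lemma in_mSyzZ s : dot s = 0 -> in_mSyz (l 1 *: s).
Proof.
by exists 0, s, 0; rewrite dot0; split=> //; row_ring.
Qed.

(** Homogeneous of degree k - 1, where degree -1 leaves only 0. *)
Definition prev_homog k (g : S) : bool :=
  if k is k'.+1 then g \is k'.-homog else g == 0.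

Section Generators.
Variables (h : S) (m : nat) (A B C : 'rV[S]_3).
Hypotheses (EA : dot A = l 0 * h) (EB : dot B = l 1 * h)
  (EC : dot C = l 2 ^+ m.+1 * h).

Local Notation kos := (koszul_syz P m A B C).

Lemma kosE : (kos 0 = l 1 *: C - l 2 ^+ m.+1 *: B)
  * (kos 1 = l 2 ^+ m.+1 *: A - l 0 *: C) * (kos 2 = l 0 *: B - l 1 *: A).
Proof. by rewrite unlock. Qed.

Lemma kos_syz i : dot (kos i) = 0.
Proof.
by case: (ord3P i) => ->; rewrite kosE dotB !dotZ ?EA ?EB ?EC; ring.
Qed.

Lemma kos_rel : l 0 *: kos 0 + l 1 *: kos 1 + l 2 ^+ m.+1 *: kos 2 = 0.
Proof. by rewrite !kosE; row_ring. Qed.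

(** If a combination of the Koszul syzygies lies in m Syz, then equating it with
    an element l 0 s0 + l 1 s1 + l 2 s2 gives a linear relation between l 0,
    l 1, l 2 with coefficients in S^3, which is Koszul; applying [dot] to it
    leaves a vector of polynomials which is, modulo J, proportional to
    (l 0, l 1, l 2).  The factor g is the only obstruction to
    u0 l_2^m h, u1 l_2^m h and u2 h being in J. *)
Lemma kos_in_mSyz u0 u1 u2 :
  in_mSyz (u0 *: kos 0 + u1 *: kos 1 + u2 *: kos 2) ->
  exists g, [/\ inJ (u0 * l 2 ^+ m * h + l 0 * g),
    inJ (u1 * l 2 ^+ m * h + l 1 * g) & inJ (u2 * h + l 2 * g)].
Proof.
move=> [s0 [s1 [s2 [S0 S1 S2 Es]]]].
pose a0 := u2 *: B - u1 *: C - s0.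
pose a1 := u0 *: C - u2 *: A - s1.
pose a2 := l 2 ^+ m *: (u1 *: A - u0 *: B) - s2.
have Ea : l 0 *: a0 + l 1 *: a1 + l 2 *: a2 = 0.
  move/eqP: Es; rewrite -subr_eq0 !kosE => /eqP <-.
  by rewrite /a0 /a1 /a2 exprS; row_ring.
have /fin_all_exists[v Hv] i : exists v : S * S * S,
    [/\ a0 0 i = l 1 * v.2 - l 2 * v.1.2, a1 0 i = l 2 * v.1.1 - l 0 * v.2
      & a2 0 i = l 0 * v.1.2 - l 1 * v.1.1].
  have Ei : l 0 * a0 0 i + l 1 * a1 0 i + l 2 * a2 0 i = 0.
    by move/rowP/(_ i): Ea; rewrite !mxE.
  by have [v0 [v1 [v2 ?]]] := dual_form_koszul P_unit Ei; exists (v0, v1, v2).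
pose v0 := \row_i (v i).1.1; pose v1 := \row_i (v i).1.2.
pose v2 := \row_i (v i).2.
have Ea0 : a0 = l 1 *: v2 - l 2 *: v1.
  by apply/rowP => i; have [E _ _] := Hv i; rewrite !mxE -E !mxE.
have Ea1 : a1 = l 2 *: v0 - l 0 *: v2.
  by apply/rowP => i; have [_ E _] := Hv i; rewrite !mxE -E !mxE.
have D0 : u2 * (l 1 * h) - u1 * (l 2 ^+ m.+1 * h) = l 1 * dot v2 - l 2 * dot v1.
  by have := congr1 dot Ea0; rewrite !dotB !dotZ EB EC S0 subr0.
have D1 : u0 * (l 2 ^+ m.+1 * h) - u2 * (l 0 * h) = l 2 * dot v0 - l 0 * dot v2.
  by have := congr1 dot Ea1; rewrite !dotB !dotZ EA EC S1 subr0.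
have [||n Eg2 Eg1] := @dual_form_regular _ _ P_unit 1 2
    (dot v2 - u2 * h) (dot v1 - u1 * l 2 ^+ m * h).
- by [].
- apply/eqP; rewrite -subr_eq0; apply/eqP.
  transitivity ((l 1 * dot v2 - l 2 * dot v1)
     - (u2 * (l 1 * h) - u1 * (l 2 ^+ m.+1 * h))); first by rewrite exprS; ring.
  by rewrite D0 subrr.
have Eg0 : dot v0 - u0 * l 2 ^+ m * h = l 0 * n.
  apply: (mulfI (dual_form_neq0 P_unit 2)).
  rewrite [RHS]mulrCA -Eg2; apply/eqP; rewrite -subr_eq0; apply/eqP.
  transitivity ((l 2 * dot v0 - l 0 * dot v2)
     - (u0 * (l 2 ^+ m.+1 * h) - u2 * (l 0 * h))); first by rewrite exprS; ring.
  by rewrite D1 subrr.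
exists n; rewrite -Eg0 -Eg1 -Eg2.
by split; rewrite addrC subrK; apply: inJ_dot.
Qed.

Lemma kos_homog k : vhom k A -> vhom k B -> vhom (k + m) C ->
  [/\ vhom (k + m).+1 (kos 0), vhom (k + m).+1 (kos 1) & vhom k.+1 (kos 2)].
Proof.
move=> hA hB hC; have hl i : l i \is 1.-homog by apply: dual_form_homog.
have hl2 := dual_form_exp_homog P 2 m.+1.
rewrite !kosE; split; apply: vhomB; first [exact: (vhomZ (hl _)) |
  rewrite -addnS addnC; exact: (vhomZ hl2)].
Qed.

(** In homogeneous situations the obstruction g can be taken homogeneous, one
    degree below the terms that it meets, and it lies in the saturation since
    all l i g do. *)
Lemma kos_descent k u0 u1 u2 : in_sat h -> u0 * l 2 ^+ m * h \is k.-homog ->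
  u1 * l 2 ^+ m * h \is k.-homog -> u2 * h \is k.-homog ->
  in_mSyz (u0 *: kos 0 + u1 *: kos 1 + u2 *: kos 2) ->
  exists g, [/\ prev_homog k g, in_sat g, inJ (u0 * l 2 ^+ m * h + l 0 * g),
    inJ (u1 * l 2 ^+ m * h + l 1 * g) & inJ (u2 * h + l 2 * g)].
Proof.
move=> Ih h0 h1 h2 /kos_in_mSyz[g [J0 J1 J2]].
pose g' := if k is k'.+1 then pihomog mdeg k' g else 0.
have Eg i : pihomog mdeg k (l i * g) = l i * g'.
  rewrite /g'; case: (k) => [|k'].
    by rewrite mulr0 (pihomogM_lt _ (dual_form_homog P i)).
  by rewrite -[k'.+1]add1n (pihomogM _ _ (dual_form_homog P i)).
have Jg x i : x \is k.-homog -> inJ (x + l i * g) -> inJ (x + l i * g').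
  move=> hx /(inJ_pihomog f_homog k).
  by rewrite pihomogD Eg pihomog_dE.
have I0 x y : in_sat x -> inJ (x + y) -> in_sat y.
  move=> Ix Jxy; rewrite -[y](addKr x) -mulN1r.
  by apply: (in_satD P_unit); [apply: in_satM | apply: inJ_in_sat].
exists g'; split; try exact: Jg.
  by rewrite /g' /prev_homog; case: (k) => // k'; apply: pihomogP.
apply: (in_sat_forms P_unit) => i; case: (ord3P i) => ->.
- by apply: I0 (Jg _ _ h0 J0); apply: in_satM.
- by apply: I0 (Jg _ _ h1 J1); apply: in_satM.
- by apply: I0 (Jg _ _ h2 J2); apply: in_satM.
Qed.

End Generators.

Lemma evp_syz s : dot s = 0 -> \sum_i evp s 0 i * (f i).@[p] = 0.
Proof.
move=> s0; transitivity ((dot s).@[p]); last by rewrite s0 meval0.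
rewrite raddf_sum /=; apply: eq_bigr => i _.
by rewrite mxE mevalM.
Qed.

(** If n = dot v then b - l 2 v and a - l 0 v are syzygies. *)
Lemma syz_mod_forms a b n : dot b = l 2 * n -> dot a = l 0 * n -> inJ n ->
  in_mSyz (l 0 *: b - l 2 *: a).
Proof.
move=> Eb Ea /inJP[v Ev]; exists (b - l 2 *: v), 0, (- (a - l 0 *: v)).
rewrite dotN !dotB !dotZ Ea Eb Ev dot0 !subrr oppr0; split=> //.
row_ring.
Qed.

Hypothesis e_gt0 : (0 < e)%N.
Variable i0 : 'I_3.
Hypothesis fp : (f i0).@[p] != 0.

(** By [dual_form_split] a syzygy vanishing at p is l 0 b - l 2 a, and
    l 0 (dot b) = l 2 (dot a) makes dot b and dot a proportional to l 2 and l 0.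
    The factor n is in the saturation because it is killed modulo J by l 0 and
    l 2, and also by a power of l 1: f i0 is congruent to a nonzero multiple of
    l 1 ^+ e modulo l 0 and l 2. *)
Lemma syz_vanish_at j s : dot s = 0 -> vhom j.+1 s -> evp s = 0 ->
  exists a b n, [/\ vhom j a, vhom j b, dot b = l 2 * n, dot a = l 0 * n
    & s = l 0 *: b - l 2 *: a] /\ (in_sat n /\ n \is (j + e).-1.-homog).
Proof.
move=> s0 hs sp.
have /fin_all_exists[v Hv] i : exists v : S * S,
   [/\ v.1 \is j.-homog, v.2 \is j.-homog & s 0 i = l 0 * v.2 - l 2 * v.1].
  have [b [a [hb ha]]] := dual_form_split P_unit (hs i).
  move/rowP/(_ i): (sp); rewrite !mxE => ->; rewrite mul0r add0r => ->.
  by exists (- a, b); split; rewrite /= ?rpredN // mulrN opprK.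
pose a := \row_i (v i).1; pose b := \row_i (v i).2.
have Es : s = l 0 *: b - l 2 *: a.
  by apply/rowP => i; have [_ _ E] := Hv i; rewrite E !mxE.
have ha : vhom j a by move=> i; have [? _ _] := Hv i; rewrite mxE.
have hb : vhom j b by move=> i; have [_ ? _] := Hv i; rewrite mxE.
have [||n En En'] := @dual_form_regular _ _ P_unit 0 2 (dot b) (dot a).
- by [].
- by apply/eqP; rewrite -subr_eq0 -!dotZ -dotB -Es s0.
have In : in_sat n.
  have J0 k : inJ (l 0 * k * n).
    by rewrite mulrAC mulrC -En'; apply/inJM/inJ_dot.
  have J2 k : inJ (l 2 * k * n).
    by rewrite mulrAC mulrC -En; apply/inJM/inJ_dot.
  have Ip : inJ (l 1 ^+ e * n).
    case: e f_homog e_gt0 => // e' fh _.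
    have [a' [b' [_ _ E]]] := dual_form_split P_unit (fh i0).
    apply: (@inJC _ _ (f i0).@[p]) => //; rewrite mulrA.
    apply: (@inJ_addl _ _ ((l 0 * a' * n) + l 2 * b' * n)).
      exact: inJD (J0 _) (J2 _).
    rewrite (_ : _ + ((f i0).@[p])%:MP * _ * n = n * f i0).
      exact/inJM/inJ_gen.
    by rewrite [in RHS]E; ring.
  exists e => g hg; case: e hg e_gt0 Ip => // e' hg _ Ip.
  have [a' [b' [_ _ ->]]] := dual_form_split P_unit hg.
  rewrite [X in inJ X](_ : _ = (g.@[p])%:MP * (l 1 ^+ e'.+1 * n)
     + l 0 * a' * n + l 2 * b' * n); last by ring.
  by apply: inJD (J2 _); apply: inJD (J0 _); apply: inJM.
exists a, b, n; split=> //; split=> //.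
apply: (dhomog_divl (dual_form_neq0 P_unit 0) (dual_form_homog P 0)).
by rewrite -En' add1n prednK ?addn_gt0 ?e_gt0 ?orbT //; apply: dot_homog.
Qed.

End KoszulSyzygies.

(** * Generators and relations of the syzygy module *)

Lemma hyperplane_dep (K : fieldType) (v0 v1 v2 : 'rV[K]_3) (w : 'I_3 -> K) i0 :
  w i0 != 0 -> \sum_i v0 0 i * w i = 0 -> \sum_i v1 0 i * w i = 0 ->
  \sum_i v2 0 i * w i = 0 ->
  exists c : 'rV[K]_3, c != 0 /\ c 0 0 *: v0 + c 0 1 *: v1 + c 0 2 *: v2 = 0.
Proof.
move=> w0 H0 H1 H2.
pose V : 'M[K]_3 := \matrix_(i, j) (if i == 0 then v0 else if i == 1 then v1 else v2) 0 j.
have Vw : V *m (\col_i w i) = 0.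
  apply/colP => i; rewrite mxE [RHS]mxE.
  case: (ord3P i) => ->; [rewrite -[RHS]H0|rewrite -[RHS]H1|rewrite -[RHS]H2];
    by apply: eq_bigr => j _; rewrite !mxE.
have nfree : ~~ row_free V.
  apply: contra w0 => fV; apply/eqP.
  have /(congr1 (mulmx (invmx V))) := Vw.
  rewrite mulmxA mulVmx -?row_free_unit // mul1mx mulmx0 => /colP/(_ i0).
  by rewrite !mxE.
have : kermx V != 0 by rewrite -kermx_eq0 in nfree.
move=> /rowV0Pn[c /sub_kermxP cV c0]; exists c; split=> //.
rewrite -cV mulmx_sum_row sum3E; congr (_ *: _ + _ *: _ + _ *: _);
 by apply/rowP => j; rewrite !mxE.
Qed.

Section NearlyFreeSyzygies.
Variables (K : fieldType) (f : 'I_3 -> {mpoly K[3]}) (e : nat).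
Hypothesis f_homog : forall i, f i \is e.-homog.
Hypothesis e_gt0 : (0 < e)%N.
Variable P : 'M[K]_3.
Hypothesis P_unit : P \in unitmx.
Local Notation S := {mpoly K[3]}.
Local Notation l := (dual_form P).
Local Notation p := (P 1).
Local Notation evp := (ev p).
Local Notation dot := (dot f).
Local Notation inJ := (in_ideal3 f).
Local Notation in_sat := (in_sat f).
Local Notation in_mSyz := (in_mSyz f P).
Variable i0 : 'I_3.
Hypothesis fp : (f i0).@[p] != 0.
Hypothesis N_dim1 : forall k u v, u \is k.-homog -> v \is k.-homog ->
  in_sat u -> in_sat v -> ~ inJ v -> exists c : K, inJ (u - c%:MP * v).

Variables (h : S) (eta alpha m : nat) (A B C : 'rV[S]_3).
Hypotheses (h_homog : h \is eta.-homog) (h_sat : in_sat h).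
Hypothesis h_least : forall k u, (k < eta)%N -> u \is k.-homog -> in_sat u -> inJ u.
Hypothesis h_chain : forall i, (i <= m)%N -> ~ inJ (l 2 ^+ i * h).
Hypotheses (hA : vhom alpha A) (hB : vhom alpha B) (hC : vhom (alpha + m) C).
Hypotheses (EA : dot A = l 0 * h) (EB : dot B = l 1 * h)
  (EC : dot C = l 2 ^+ m.+1 * h).
Hypothesis alpha_eta : eta.+1 = (alpha + e)%N.
Local Notation r := (koszul_syz P m A B C).

Let r_homog := kos_homog P hA hB hC.
Let r_syz i : dot (r i) = 0 := kos_syz EA EB EC i.

Let chain_homog i : l 2 ^+ i * h \is (eta + i).-homog.
Proof. by rewrite addnC; apply: dhomogM => //; apply: dual_form_exp_homog. Qed.

Let Jl0h : inJ (l 0 * h). Proof. by rewrite -EA; apply: inJ_dot. Qed.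

(** In degree eta + m - 1 the module N is either 0 or spanned by a term of the
    chain, and l 0 kills the chain. *)
Lemma form0_kills_below_top g : prev_homog (eta + m) g -> in_sat g -> inJ (l 0 * g).
Proof.
case Em: (eta + m)%N => [|k] /= hg Ig; first by rewrite (eqP hg) mulr0; apply: inJ0.
have [ke|ek] := ltnP k eta; first by apply: inJM; apply: h_least hg Ig.
have km : (k - eta <= m)%N by lia.
have [|||c Jc] := N_dim1 (v := l 2 ^+ (k - eta) * h) hg _ Ig.
- by have := chain_homog (k - eta); rewrite subnKC.
- exact: in_satM.
- exact: h_chain.
rewrite (_ : l 0 * g = l 0 * (g - c%:MP * (l 2 ^+ (k - eta) * h))
   + c%:MP * l 2 ^+ (k - eta) * (l 0 * h)); last by ring.
by apply: inJD; apply: inJM.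
Qed.

(** The class in N attached to s is a multiple of a term l 2 ^+ i h of the chain
    with i < m, and it is killed by l 2 while l 2 ^+ i.+1 h is not 0. *)
Lemma vanish_below_top j s : (j < alpha + m)%N -> dot s = 0 -> vhom j.+1 s ->
  evp s = 0 -> in_mSyz s.
Proof.
move=> jm s0 hs sp.
have [a [b [n [[ha hb Eb Ea ->] [In hn]]]]] := syz_vanish_at f_homog P_unit e_gt0 fp s0 hs sp.
apply: (syz_mod_forms Eb Ea).
have [ke|ek] := ltnP (j + e).-1 eta; first exact: h_least hn In.
have km : ((j + e).-1 - eta < m)%N by lia.
have [|||c Jc] := N_dim1 (v := l 2 ^+ ((j + e).-1 - eta) * h) hn _ In.
- by have := chain_homog ((j + e).-1 - eta); rewrite subnKC.
- exact: in_satM.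
- by apply: h_chain; apply: ltnW.
have [c0|c0] := eqVneq c 0; first by move: Jc; rewrite c0 mpolyC0 mul0r subr0.
case: (h_chain km); apply: (inJC c0); rewrite exprS.
rewrite [X in inJ X](_ : _ = l 2 * n
  - l 2 * (n - c%:MP * (l 2 ^+ ((j + e).-1 - eta) * h))); last by ring.
by apply: inJB; [rewrite -Eb; apply: inJ_dot | apply: inJM].
Qed.

(** The class attached to s is a multiple of l 2 ^+ m h, which is the class
    attached to - r 1. *)
Lemma vanish_at_top s : dot s = 0 -> vhom (alpha + m).+1 s -> evp s = 0 ->
  exists c : K, in_mSyz (s + c%:MP *: r 1).
Proof.
move=> s0 hs sp.
have [a [b [n [[ha hb Eb Ea ->] [In hn]]]]] := syz_vanish_at f_homog P_unit e_gt0 fp s0 hs sp.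
have [|||c Jc] := N_dim1 (v := l 2 ^+ m * h) hn _ In.
- by rewrite (_ : _.-1 = eta + m)%N //; lia.
- exact: in_satM.
- exact: h_chain.
exists c.
rewrite [X in in_mSyz X](_ : _ = l 0 *: (b - c%:MP *: C) - l 2 *: (a - (c%:MP * l 2 ^+ m) *: A)).
  apply: (@syz_mod_forms _ _ _ _ _ (n - c%:MP * (l 2 ^+ m * h))) Jc.
  - by rewrite dotB dotZ Eb EC exprS; ring.
  - by rewrite dotB dotZ Ea EA; ring.
by rewrite kosE exprS; row_ring.
Qed.

(** If r 2 and l 1 s had the same value at p, their difference would vanish there,
    so r 2 would be a multiple of r 1 modulo m Syz.  By [kos_descent] the class
    of h would be - l 2 times a class of degree eta - 1, where N is 0. *)
Lemma kos2_jump s : dot s = 0 -> vhom alpha s -> evp (r 2) <> evp s.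
Proof.
move=> s0 hs Ep.
have [h0 h1 h2] := r_homog.
pose t := r 2 - l 1 *: s.
have t0 : dot t = 0 by rewrite dotB dotZ s0 mulr0 subr0.
have ht : vhom alpha.+1 t by apply: vhomB => //; apply: (vhomZ (dual_form_homog P 1)).
have tp : evp t = 0 by rewrite evB evZ dual_form_eval // scale1r Ep subrr.
have [c mc tc] : exists2 c : K, (m = 0%N \/ c = 0) & in_mSyz (t + c%:MP *: r 1).
  have [m0|m_gt0] := posnP m.
    have [||c tc] := @vanish_at_top t t0; [by rewrite m0 addn0|by []|].
    by exists c => //; left.
  exists 0; first by right.
  rewrite mpolyC0 scale0r addr0; apply: vanish_below_top t0 ht tp.
  by rewrite -addn1 leq_add2l.
have Er : in_mSyz (0 *: r 0 + c%:MP *: r 1 + 1 *: r 2).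
  rewrite [X in in_mSyz X](_ : _ = t + c%:MP *: r 1 + l 1 *: s); last by rewrite /t; row_ring.
  by apply: in_mSyzD => //; apply: in_mSyzZ.
have [|||g [hg Ig _ _ Jg]] := kos_descent f_homog P_unit EA EB EC (k := eta) h_sat _ _ _ Er.
- by rewrite !mul0r rpred0.
- case: mc => [->|->]; last by rewrite mpolyC0 !mul0r rpred0.
  by rewrite expr0 mulr1; apply: dhomogCM.
- by rewrite mul1r.
have Jg' : inJ g.
  case: eta hg h_least => [/eqP->|k hg hl]; first by move=> _; apply: inJ0.
  by apply: hl hg Ig.
apply: (@h_chain 0) => //; rewrite expr0.
by move: Jg; rewrite mul1r addrC; apply/inJ_addl/inJM.
Qed.

(** As for [kos2_jump], except that the obstruction g has degree eta + m - 1,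
    where l 0 acts by zero on N; so the end l 2 ^+ m h = - l 0 g of the chain
    would be 0 in N. *)
Lemma kos0_jump (beta : K) s : dot s = 0 -> vhom (alpha + m) s ->
  evp (r 0) <> evp s + beta *: evp (r 2).
Proof.
move=> s0 hs Ep.
have [h0 h1 h2] := r_homog.
pose b := beta%:MP * l 1 ^+ m.
pose t := r 0 - l 1 *: s - b *: r 2.
have t0 : dot t = 0.
  by rewrite /t 2!dotB 2!dotZ s0 !r_syz !mulr0 !subr0.
have hb : b \is m.-homog by apply/dhomogCM/dual_form_exp_homog.
have ht : vhom (alpha + m).+1 t.
  apply: vhomB; last by rewrite addnC -addnS; apply: vhomZ.
  by apply: vhomB => //; apply: (vhomZ (dual_form_homog P 1)).
have tp : evp t = 0.
  rewrite /t 2!evB 2!evZ /b mevalM mevalC rmorphXn /= !dual_form_eval // eqxx.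
  by rewrite scale1r expr1n mulr1 Ep addrAC addrK subrr.
have [c tc] := vanish_at_top t0 ht tp.
have Er : in_mSyz (1 *: r 0 + c%:MP *: r 1 + (- b) *: r 2).
  rewrite [X in in_mSyz X](_ : _ = t + c%:MP *: r 1 + l 1 *: s); last by rewrite /t; row_ring.
  by apply: in_mSyzD => //; apply: in_mSyzZ.
have [|||g [hg Ig Jg _ _]] := kos_descent f_homog P_unit EA EB EC (k := eta + m) h_sat _ _ _ Er.
- by rewrite mul1r.
- by rewrite -mulrA; apply: dhomogCM.
- by rewrite addnC; apply: dhomogM => //; rewrite rpredN.
have Jg' := form0_kills_below_top hg Ig.
apply: (@h_chain m) => //.
by move: Jg; rewrite mul1r addrC; apply/inJ_addl.
Qed.

(** Three vectors of the plane orthogonal to (f_i(p)) are dependent, and the two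
    previous lemmas, with s = 0, make the values of r 0 and r 2 independent. *)
Lemma kos_span_fiber t : dot t = 0 ->
  exists x y : K, evp t = x *: evp (r 0) + y *: evp (r 2).
Proof.
move=> t0.
have [c [c0 E]] := hyperplane_dep fp (evp_syz P t0) (evp_syz P (r_syz 0))
  (evp_syz P (r_syz 2)).
have ev0 : evp 0 = 0 by exact: raddf0.
have vs0 k : dot 0 = 0 /\ vhom (K := K) k 0 by split; [apply: dot0|apply: vhom0].
have [c00|c00] := eqVneq (c 0 0) 0; last first.
  exists (- (c 0 0)^-1 * c 0 1), (- (c 0 0)^-1 * c 0 2).
  apply: (scalerI c00); rewrite scalerDr !scalerA !mulrA !mulrN !mulfV //.
  by rewrite !mulN1r !scaleNr -opprD; apply/eqP; rewrite -addr_eq0 addrA E.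
move: E; rewrite c00 scale0r add0r => E.
have [c01|c01] := eqVneq (c 0 1) 0.
  move: E; rewrite c01 scale0r add0r => /eqP; rewrite scaler_eq0.
  have [c02|_ /= /eqP r20] := eqVneq (c 0 2) 0.
    case/eqP: c0; apply/rowP => i.
    by rewrite [RHS]mxE; case: (ord3P i) => ->.
  have [d0 v0] := vs0 alpha.
  by case: (kos2_jump d0 v0); rewrite r20 ev0.
have [d0 v0] := vs0 (alpha + m)%N.
case: (@kos0_jump (- (c 0 1)^-1 * c 0 2) _ d0 v0).
apply: (scalerI c01); rewrite scalerDr !scalerA mulrA mulrN mulfV //.
rewrite mulN1r scaleNr ev0 scaler0 add0r.
by apply/eqP; rewrite -addr_eq0 E.
Qed.

(** A socle element n of degree d has its own Koszul syzygies r', for which m = 0.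
    The values of r' 0 and r' 2 at p are those of l 1 times a syzygy, as the
    plane is exhausted, so both are multiples of r' 1 modulo m Syz.  The two
    obstructions g and g' of [kos_descent] lie in N_(d-1), where g is not 0 as
    l 0 g = - n; hence g' is a multiple of g, but l 2 g = 0 while
    l 2 g' = - n. *)
Lemma no_socle_above n d : (eta + m < d)%N -> n \is d.-homog -> in_sat n ->
  (forall i, inJ (l i * n)) -> inJ n.
Proof.
move=> dm hn In Jn; have [//|nJ] := pselect (inJ n); exfalso.
have [j Ea'] : exists j, d.+1 = (e + (alpha + m + j.+1))%N.
  by exists (d - (eta + m).+1)%N; lia.
pose a' := (alpha + m + j.+1)%N.
have hln i : l i * n \is (e + a').-homog.
  by rewrite -Ea' -[d.+1]add1n; apply: dhomogM => //; apply: dual_form_homog.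
have [A' hA' EA'] := inJ_homog f_homog (hln 0) (Jn 0).
have [B' hB' EB'] := inJ_homog f_homog (hln 1) (Jn 1).
have [C' hC' EC'] := inJ_homog f_homog (hln 2) (Jn 2).
have EC1 : dot C' = l 2 ^+ 1 * n by [].
have hC1 : vhom (a' + 0) C' by rewrite addn0.
pose r' := koszul_syz P 0 A' B' C'.
have r'_syz i : dot (r' i) = 0 := kos_syz (esym EA') (esym EB') EC1 i.
have [] := kos_homog P hA' hB' hC1; rewrite addn0 -/r' => hr0 hr1 hr2.
have key t : dot t = 0 -> vhom a'.+1 t -> exists c : K, in_mSyz (t + c%:MP *: r' 1).
  move=> t0 ht; have [x [y E]] := kos_span_fiber t0.
  pose s := (x%:MP * l 1 ^+ j) *: r 0 + (y%:MP * l 1 ^+ (m + j)) *: r 2.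
  have [h0 h1 h2] := r_homog.
  have s0 : dot s = 0 by rewrite dotD 2!dotZ !r_syz !mulr0 addr0.
  have hs : vhom a' s.
    apply: vhomD.
      rewrite (_ : a' = j + (alpha + m).+1)%N; last by rewrite /a'; lia.
      by apply: vhomZ h0; apply/dhomogCM/dual_form_exp_homog.
    rewrite (_ : a' = m + j + alpha.+1)%N; last by rewrite /a'; lia.
    by apply: vhomZ h2; apply/dhomogCM/dual_form_exp_homog.
  have u0 : dot (t - l 1 *: s) = 0 by rewrite dotB dotZ s0 t0 mulr0 subr0.
  have hu : vhom a'.+1 (t - l 1 *: s).
    by apply: vhomB => //; apply: (vhomZ (dual_form_homog P 1)).
  have up : evp (t - l 1 *: s) = 0.
    rewrite evB evZ dual_form_eval // eqxx scale1r /s evD 2!evZ !mevalM !mevalC.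
    by rewrite !rmorphXn /= !dual_form_eval // eqxx !expr1n !mulr1 E subrr.
  have [a [b [k [[ha hb Eb Ea Eu] [Ik hk]]]]] :=
    syz_vanish_at f_homog P_unit e_gt0 fp u0 hu up.
  have hk' : k \is d.-homog by rewrite (_ : d = (a' + e).-1)%N //; rewrite /a'; lia.
  have [c Jc] := N_dim1 hk' hn Ik In nJ; exists c.
  rewrite [X in in_mSyz X](_ : _ = (l 0 *: (b - c%:MP *: C')
      - l 2 *: (a - c%:MP *: A')) + l 1 *: s); last first.
    rewrite /r' kosE expr1 -[t](subrK (l 1 *: s)) Eu; row_ring.
  apply: in_mSyzD; last exact: in_mSyzZ.
  by apply: syz_mod_forms Jc; rewrite dotB dotZ -?EC' -?EA' ?Ea ?Eb; ring.
have proj (t u : 'rV[S]_3) : in_mSyz t -> t = u -> in_mSyz u by move=> ? <-.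
have [|c0 M0] := key (r' 0) (r'_syz 0); first exact: hr0.
have [|c2 M2] := key (r' 2) (r'_syz 2); first exact: hr2.
have {}M0 : in_mSyz (1 *: r' 0 + c0%:MP *: r' 1 + 0 *: r' 2).
  by apply: proj M0 _; rewrite scale1r scale0r addr0.
have {}M2 : in_mSyz (0 *: r' 0 + c2%:MP *: r' 1 + 1 *: r' 2).
  by apply: proj M2 _; rewrite scale1r scale0r add0r addrC.
have hc (c : K) : c%:MP * l 2 ^+ 0 * n \is d.-homog.
  by rewrite expr0 mulr1; apply: dhomogCM.
have h1n : 1 * l 2 ^+ 0 * n \is d.-homog by rewrite !mul1r.
have h0n : 0 * l 2 ^+ 0 * n \is d.-homog by rewrite !mul0r rpred0.
have h1n' : 1 * n \is d.-homog by rewrite mul1r.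
have h0n' : 0 * n \is d.-homog by rewrite mul0r rpred0.
have [g [hg Ig J0 _ J2]] := kos_descent f_homog P_unit (esym EA') (esym EB')
  EC1 In h1n (hc c0) h0n' M0.
have [g' [hg' Ig' J0' _ J2']] := kos_descent f_homog P_unit (esym EA') (esym EB')
  EC1 In h0n (hc c2) h1n' M2.
move: hg hg'; case: (d) dm => [//|k] _ /= hg hg'.
rewrite mul0r add0r in J2; rewrite mul1r in J2'; rewrite expr0 !mul1r in J0.
have [Jg|gJ] := pselect (inJ g).
  by apply: nJ; move: J0; rewrite addrC; apply/inJ_addl/inJM.
have [c Jc] := N_dim1 hg' hg Ig' Ig gJ.
apply: nJ; move: J2'; rewrite addrC; apply: inJ_addl.
rewrite (_ : _ * g' = l 2 * (g' - c%:MP * g) + c%:MP * (l 2 * g)); last by ring.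
by apply: inJD; apply: inJM.
Qed.

(** If the class n attached to s were not 0, its last nonzero multiple by a power
    of l 1 would be a socle element beyond the chain. *)
Lemma vanish_above_top j s : (alpha + m < j)%N -> dot s = 0 -> vhom j.+1 s ->
  evp s = 0 -> in_mSyz s.
Proof.
move=> jm s0 hs sp.
have [a [b [n [[ha hb Eb Ea ->] [In hn]]]]] := syz_vanish_at f_homog P_unit e_gt0 fp s0 hs sp.
apply: (syz_mod_forms Eb Ea).
have [//|nJ] := pselect (inJ n); exfalso.
have [i [nJi Ji]] : exists i, ~ inJ (l 1 ^+ i * n) /\ inJ (l 1 ^+ i.+1 * n).
  have [k Hk] := In; have := Hk _ (dual_form_exp_homog P 1 k).
  elim: k {Hk} => [|k IH] Jk; first by case: nJ; rewrite expr0 mul1r in Jk.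
  have [/IH//|nJk] := pselect (inJ (l 1 ^+ k * n)).
  by exists k.
have Jl0 : inJ (l 0 * n) by rewrite -Ea; apply: inJ_dot.
have Jl2 : inJ (l 2 * n) by rewrite -Eb; apply: inJ_dot.
apply: nJi; apply: (@no_socle_above _ (i + (j + e).-1)).
- lia.
- by apply: dhomogM => //; apply: dual_form_exp_homog.
- exact: in_satM.
move=> k; case: (ord3P k) => ->; last 1 first.
- by rewrite mulrCA; apply: inJM.
- by rewrite mulrCA; apply: inJM.
- by rewrite mulrA -exprS.
Qed.

(** The combination t of r 0 and r 2 with the same value as s at p exists in the
    degree of s: the coefficient of r 0 or r 2 vanishes as long as the degree of
    s is too low for this syzygy, by [kos0_jump] and [kos2_jump]. *)
Lemma kos_generate_mod j s : dot s = 0 -> vhom j.+1 s ->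
  exists t, [/\ exists u0 u1 u2, t = u0 *: r 0 + u1 *: r 1 + u2 *: r 2,
    vhom j.+1 t & in_mSyz (s - t)].
Proof.
move=> s0 hs; have [h0 h1 h2] := r_homog.
have [x [y E]] := kos_span_fiber s0.
have ll k : (l 1 ^+ k).@[p] = 1 by rewrite rmorphXn /= dual_form_eval // eqxx expr1n.
have x0 : (j < alpha + m)%N -> x = 0.
  move=> jm; have [//|xn] := eqVneq x 0; exfalso.
  pose k := (alpha + m - j.+1)%N.
  apply: (@kos0_jump (- x^-1 * y) ((x^-1%:MP * l 1 ^+ k) *: s)).
  - by rewrite dotZ s0 mulr0.
  - rewrite (_ : alpha + m = k + j.+1)%N; last by rewrite /k; lia.
    by apply: vhomZ hs; apply/dhomogCM/dual_form_exp_homog.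
  rewrite evZ mevalM mevalC ll // mulr1 E scalerDr !scalerA mulVf // scale1r.
  by rewrite mulNr scaleNr addrK.
have y0 : (j < alpha)%N -> y = 0.
  move=> ja; have [//|yn] := eqVneq y 0; exfalso.
  have xz : x = 0 by apply: x0; lia.
  pose k := (alpha - j.+1)%N.
  apply: (@kos2_jump ((y^-1%:MP * l 1 ^+ k) *: s)).
  - by rewrite dotZ s0 mulr0.
  - rewrite [X in vhom X _](_ : alpha = k + j.+1)%N; last by rewrite /k; lia.
    by apply: vhomZ hs; apply/dhomogCM/dual_form_exp_homog.
  by rewrite evZ mevalM mevalC ll // mulr1 E xz scale0r add0r scalerA mulVf // scale1r.
pose t := (x%:MP * l 1 ^+ (j - (alpha + m))) *: r 0
  + (y%:MP * l 1 ^+ (j - alpha)) *: r 2.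
have t_syz : dot t = 0 by rewrite dotD 2!dotZ !r_syz !mulr0 addr0.
have ht : vhom j.+1 t.
  apply: vhomD.
    have [/x0->|mj] := ltnP j (alpha + m); first by rewrite mpolyC0 mul0r scale0r; apply: vhom0.
    rewrite (_ : j.+1 = j - (alpha + m) + (alpha + m).+1)%N; last by lia.
    by apply: vhomZ h0; apply/dhomogCM/dual_form_exp_homog.
  have [/y0->|mj] := ltnP j alpha; first by rewrite mpolyC0 mul0r scale0r; apply: vhom0.
  rewrite (_ : j.+1 = j - alpha + alpha.+1)%N; last by lia.
  by apply: vhomZ h2; apply/dhomogCM/dual_form_exp_homog.
have u0 : dot (s - t) = 0 by rewrite dotB s0 t_syz subr0.
have hu : vhom j.+1 (s - t) by apply: vhomB.
have up : evp (s - t) = 0.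
  by rewrite evB /t evD 2!evZ !mevalM !mevalC !ll // !mulr1 E subrr.
have [jm|mj|jE] := ltngtP j (alpha + m).
- exists t; split=> //; last exact: vanish_below_top jm u0 hu up.
  exists (x%:MP * l 1 ^+ (j - (alpha + m))), 0, (y%:MP * l 1 ^+ (j - alpha)).
  by rewrite /t; row_ring.
- exists t; split=> //; last exact: vanish_above_top mj u0 hu up.
  exists (x%:MP * l 1 ^+ (j - (alpha + m))), 0, (y%:MP * l 1 ^+ (j - alpha)).
  by rewrite /t; row_ring.
have [|c Hc] := vanish_at_top u0 _ up; first by rewrite -jE.
exists (t - c%:MP *: r 1); split=> //.
- exists (x%:MP * l 1 ^+ (j - (alpha + m))), (- c%:MP),
    (y%:MP * l 1 ^+ (j - alpha)); rewrite /t; row_ring.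
- apply: vhomB => //; rewrite -[j.+1]add0n; apply: vhomZ; first exact: dhomogC.
  by rewrite jE.
- by rewrite [X in in_mSyz X](_ : _ = s - t + c%:MP *: r 1) //; row_ring.
Qed.

(** Some 2 x 2 minor of (r 0, r 2) does not vanish at p. *)
Lemma kos02_free x y : x *: r 0 + y *: r 2 = 0 -> x = 0 /\ y = 0.
Proof.
move=> E.
have ev0 : evp 0 = 0 by exact: raddf0.
have Ei i : x * r 0 0 i + y * r 2 0 i = 0.
  by move/rowP/(_ i): E; rewrite [LHS]mxE [X in X + _]mxE [X in _ + X]mxE [RHS]mxE.
have [i ri] : exists i, (r 2 0 i).@[p] != 0.
  apply: contrapT => H; apply: (@kos2_jump 0 (dot0 f) (vhom0 _ _)).
  rewrite ev0; apply/rowP => i; rewrite mxE [RHS]mxE; apply/eqP/negbNE/negP => ri.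
  by apply: H; exists i.
have [j rij] : exists j, (r 0 0 i * r 2 0 j - r 0 0 j * r 2 0 i).@[p] != 0.
  apply: contrapT => H.
  apply: (@kos0_jump ((r 0 0 i).@[p] / (r 2 0 i).@[p]) 0 (dot0 f) (vhom0 _ _)).
  rewrite ev0 add0r; apply/rowP => j; rewrite [LHS]mxE [RHS]mxE [X in _ * X]mxE.
  apply: (mulIf ri); rewrite mulrAC divfK //; apply/eqP.
  rewrite eq_sym -subr_eq0 -!mevalM -mevalB.
  by apply/negbNE/negP => rij; apply: H; exists j.
have x0 : x = 0.
  have : x * (r 0 0 i * r 2 0 j - r 0 0 j * r 2 0 i) == 0.
    rewrite (_ : _ * _ = r 2 0 j * (x * r 0 0 i + y * r 2 0 i)
       - r 2 0 i * (x * r 0 0 j + y * r 2 0 j)); last by ring.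
    by rewrite !Ei !mulr0 subrr.
  rewrite mulf_eq0 => /orP[/eqP//|/eqP r0].
  by rewrite r0 meval0 eqxx in rij.
split=> //; move: (Ei i); rewrite x0 mul0r add0r => /eqP.
rewrite mulf_eq0 => /orP[/eqP//|/eqP r0].
by rewrite r0 meval0 eqxx in ri.
Qed.

(** Eliminating r 1 with the known relation leaves a relation between r 0 and
    r 2. *)
Lemma kos_relations c0 c1 c2 : c0 *: r 0 + c1 *: r 1 + c2 *: r 2 = 0 ->
  exists u, [/\ c0 = u * l 0, c1 = u * l 1 & c2 = u * l 2 ^+ m.+1].
Proof.
move=> E.
have [] := @kos02_free (l 1 * c0 - c1 * l 0) (l 1 * c2 - c1 * l 2 ^+ m.+1).
  transitivity (l 1 *: (c0 *: r 0 + c1 *: r 1 + c2 *: r 2)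
    - c1 *: (l 0 *: r 0 + l 1 *: r 1 + l 2 ^+ m.+1 *: r 2)); first by row_ring.
  by rewrite E (kos_rel P) !scaler0 subrr.
move=> /eqP; rewrite subr_eq0 [c1 * _]mulrC => /eqP E0 /eqP.
rewrite subr_eq0 => /eqP E2.
have [//||u Eu Eu'] := @dual_form_regular _ _ P_unit 1 0 c0 c1; first exact: E0.
exists u; split; rewrite ?Eu ?Eu' 1?mulrC //.
apply: (mulfI (dual_form_neq0 P_unit 1)); rewrite E2 Eu'; ring.
Qed.

(** Graded Nakayama lemma: by induction on the degree, the elements of m Syz are
    combinations of the r i once all syzygies of lower degree are. *)
Lemma kos_generate : (forall s, dot s = 0 -> vhom 0 s -> s = 0) ->
  forall s, dot s = 0 -> exists u0 u1 u2, s = u0 *: r 0 + u1 *: r 1 + u2 *: r 2.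
Proof.
move=> no_const.
pose gen s := exists u0 u1 u2, s = u0 *: r 0 + u1 *: r 1 + u2 *: r 2.
have genD s t : gen s -> gen t -> gen (s + t).
  move=> [u0 [u1 [u2 ->]]] [v0 [v1 [v2 ->]]].
  by exists (u0 + v0), (u1 + v1), (u2 + v2); row_ring.
have genZ c s : gen s -> gen (c *: s).
  move=> [u0 [u1 [u2 ->]]].
  by exists (c * u0), (c * u1), (c * u2); row_ring.
have gen0 : gen 0 by exists 0, 0, 0; row_ring.
have hom j : forall s, dot s = 0 -> vhom j s -> gen s.
  elim: j => [|j IH] s s0 hs; first by rewrite (no_const s).
  have [t [gt ht [s0' [s1' [s2' [S0 S1 S2 Est]]]]]] := kos_generate_mod s0 hs.
  rewrite -[s](subrK t); apply: (genD) => //.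
  have -> : s - t = l 0 *: vpi j s0' + l 1 *: vpi j s1' + l 2 *: vpi j s2'.
    apply/rowP => i; have hst := vhomB hs ht.
    rewrite -(pihomog_dE (hst i)) Est !mxE !pihomogD -[j.+1]add1n.
    by rewrite !(pihomogM j _ (dual_form_homog P _)).
  have gv k t' : dot t' = 0 -> gen (l k *: vpi j t').
    move=> t'0; apply: (genZ); apply: IH; last exact: vpi_hom.
    exact: (syz_pihomog f_homog).
  by apply: (genD); [apply: (genD)|]; apply: gv.
move=> s s0.
pose N := (\max_(i < 3) msize (s ord0 i))%N.
have -> : s = \sum_(d < N) vpi d s.
  apply/rowP => i; rewrite summxE [LHS](@pihomog_partitionE _ _ mdeg N).
    by apply: eq_bigr => d _; rewrite mxE.
  exact: (leq_bigmax i).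
apply: (big_ind gen) => // d _; apply: (hom d); last exact: vpi_hom.
exact: (syz_pihomog f_homog).
Qed.

End NearlyFreeSyzygies.

(** * Univariate restrictions and evaluation points *)

Section Char0.
Variable K : numFieldType.

Lemma poly_nonroot (p : {poly K}) : p != 0 -> exists x, p.[x] != 0.
Proof.
move=> p0; apply: contrapT => H.
pose s := [seq i%:R : K | i <- iota 0 (size p)].
have us : uniq s.
  by rewrite map_inj_uniq ?iota_uniq // => i j /eqP; rewrite eqr_nat => /eqP.
have rs : all (root p) s.
  apply/allP => x _; apply/negbNE/negP => px; apply: H; exists x.
  by rewrite /root in px.
by have := max_poly_roots p0 rs us; rewrite size_map size_iota ltnn.
Qed.

Lemma deriv0_const (p : {poly K}) : p^`() = 0 -> p = (p.[0])%:P.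
Proof.
move=> dp; apply/polyP => -[|i]; rewrite coefC //= ?horner_coef0 //.
have := congr1 (fun r : {poly K} => r`_i) dp.
by rewrite coef_deriv coef0 => /eqP; rewrite mulrn_eq0 => /eqP.
Qed.

(** The restriction of g to the line through a with direction b. *)
Definition line_poly n (a b : 'I_n -> K) : {mpoly K[n]} -> {poly K} :=
  mmap (@polyC K) (fun i => (a i)%:P + b i *: 'X).

Lemma horner_line_poly n a b (g : {mpoly K[n]}) x :
  (line_poly a b g).[x] = g.@[fun i => a i + x * b i].
Proof.
rewrite /line_poly /mmap horner_sum mevalE; apply: eq_bigr => m _.
rewrite hornerM hornerC; congr (_ * _); rewrite /mmap1 horner_prod.
by apply: eq_bigr => i _; rewrite horner_exp !hornerE mulrC.
Qed.

Lemma deriv_line_poly n a b (g : {mpoly K[n]}) :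
  (line_poly a b g)^`() = \sum_i b i *: line_poly a b g^`M(i).
Proof.
elim/mpoly_ring_ind: g => [c|i|g h IHg IHh|g h IHg IHh].
- rewrite /line_poly mmapC derivC big1 // => i _.
  by rewrite mderivC raddf0 scaler0.
- rewrite /line_poly mmapX mmap1U derivD derivC add0r derivZ derivX.
  rewrite (bigD1 i) //= mderivX mnm1E eqxx scale1r.
  rewrite big1 => [|j ji].
    rewrite addr0 (_ : (U_(i) - U_(i))%MM = 0%MM) ?mpolyX0 ?rmorph1 //.
    by apply/mnmP => j; rewrite mnmBE subnn mnm0E.
  by rewrite mderivX mnm1E eq_sym (negbTE ji) scale0r raddf0 scaler0.
- rewrite /line_poly raddfD derivD IHg IHh -big_split /=.
  by apply: eq_bigr => i _; rewrite mderivD raddfD scalerDr.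
- rewrite {1}/line_poly rmorphM -!/(line_poly a b _) derivM IHg IHh.
  rewrite mulr_suml mulr_sumr -big_split /=.
  apply: eq_bigr => i _.
  rewrite mderivM /line_poly raddfD /= !rmorphM /= scalerDr.
  by rewrite -scalerAl -scalerAr.
Qed.

End Char0.

Section Points.
Variable K : numFieldType.
Local Notation S := {mpoly K[3]}.

Lemma meval_scale n k (g : {mpoly K[n]}) a v : g \is k.-homog ->
  g.@[fun i => a * v i] = a ^+ k * g.@[v].
Proof.
move=> /dhomogP hg; rewrite !mevalE mulr_sumr !big_seq; apply: eq_bigr => m mg.
rewrite mulrCA; congr (_ * _).
under eq_bigr do rewrite exprMn.
by rewrite big_split /= -expr_sum -mdegE hg.
Qed.

(** Kronecker substitution: sending the variables to x, x^D and x^(D^2), with D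
    larger than all exponents, keeps distinct monomials distinct. *)
Lemma meval_nonzero (g : S) : g != 0 -> exists v, g.@[v] != 0.
Proof.
move=> g0; pose D := msize g.
pose w (m : 'X_{1..3}) := (m (0 : 'I_3)%R + D * (m (1 : 'I_3)%R + D * m (2 : 'I_3)%R))%N.
pose G : {poly K} := \sum_(m <- msupp g) g@_m *: 'X^(w m).
have ltD m : m \in msupp g -> forall i, (m i < D)%N.
  move=> mg i; apply: leq_ltn_trans (msize_mdeg_lt mg).
  by rewrite mdegE (bigD1 i) //= leq_addr.
have w_inj m m' : m \in msupp g -> m' \in msupp g -> w m = w m' -> m = m'.
  move=> mg mg' E; have H := ltD m mg; have H' := ltD m' mg'.
  have D0 : (0 < D)%N by apply: leq_trans (H 0).
  have digit a b a' b' : (a < D)%N -> (a' < D)%N ->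
      (a + D * b = a' + D * b')%N -> a = a' /\ b = b'.
    move=> aD aD' Eab.
    have := congr1 (modn ^~ D) Eab;
    rewrite !(addnC _ (D * _)%N) !(mulnC D) !modnMDl !modn_small //.
    move=> Ea; split=> //; move/eqP: Eab; rewrite Ea eqn_add2l eqn_pmul2l //.
    by move/eqP.
  have [E0 {}E] := digit _ _ _ _ (H 0) (H' 0) E.
  have [E1 E2] := digit _ _ _ _ (H 1) (H' 1) E.
  by apply/mnmP => i; case: (ord3P i) => ->.
have G0 : G != 0.
  have mg := mlead_supp g0; apply/eqP => /(congr1 (fun r : {poly K} => r`_(w (mlead g)))).
  rewrite coef0 coef_sum (bigD1_seq _ mg) //= coefZ coefXn eqxx mulr1.
  rewrite big_seq_cond big1 => [|m /andP[mg' ne]].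
    by rewrite addr0 => /eqP; rewrite mleadc_eq0 (negbTE g0).
  rewrite coefZ coefXn; case: eqP => [E|]; last by rewrite mulr0.
  by rewrite (w_inj _ _ mg' mg (esym E)) eqxx in ne.
have [x Gx] := poly_nonroot G0.
exists (fun i : 'I_3 => x ^+ (D ^ i)); apply: contra Gx => /eqP gx; apply/eqP.
rewrite -[RHS]gx mevalE horner_sum; apply: eq_bigr => m _.
rewrite hornerZ hornerXn; congr (_ * _).
under eq_bigr do rewrite -exprM.
rewrite -expr_sum; congr (_ ^+ _).
rewrite !big_ord_recl big_ord0 /=.
have -> : w m = (m ord0
    + D * (m (lift ord0 ord0) + D * m (lift ord0 (lift ord0 ord0))))%N.
  by congr (m _ + D * (m _ + D * m _))%N; apply: val_inj.
by rewrite /bump /=; lia.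
Qed.

(** The derivative of f along the line vanishes, and the characteristic is 0. *)
Lemma directional_const (f : S) (c x : 'I_3 -> K) t :
  \sum_i (c i)%:MP * f^`M(i) = 0 -> f.@[fun i => x i + t * c i] = f.@[x].
Proof.
move=> Ec.
have E : (line_poly x c f)^`() = 0.
  rewrite deriv_line_poly -[RHS](rmorph0 (mmap (@polyC K) (fun i => (x i)%:P + c i *: 'X))).
  rewrite -Ec rmorph_sum; apply: eq_bigr => i _.
  by rewrite rmorphM /= mmapC mul_polyC.
rewrite -horner_line_poly (deriv0_const E) hornerC horner_line_poly.
by apply: meval_eq => i; rewrite mul0r addr0.
Qed.

End Points.

(** * Constant syzygies and concurrent lines *)

Section Concurrent.
Variable K : numClosedFieldType.
Local Notation S := {mpoly K[3]}.

(** Coordinates are numbered from a chosen k, in the cyclic order of 'I_3. *)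
Lemma ord3_cycle (k i : 'I_3) : [\/ i = k, i = k + 1 | i = k + 2].
Proof.
case: (ord3P k) => ->; case: (ord3P i) => ->;
  by [apply: Or31; apply: val_inj|apply: Or32; apply: val_inj|apply: Or33; apply: val_inj].
Qed.

Lemma ord3_cycle_neq (k : 'I_3) :
  [/\ (k + 1 == k) = false, (k + 2 == k) = false, (k + 2 == k + 1) = false
    & (k == k + 1) = false /\ ((k == k + 2) = false /\ (k + 1 == k + 2) = false)].
Proof. by case: (ord3P k) => ->. Qed.

(** Since f is constant along c, it only depends on the projection y of its
    argument along c to the plane where the coordinate k vanishes.  There f is a
    binary form in y_j, y_t, and factoring its dehomogenization G gives the
    lines y_j = z y_t; the line y_t = 0 has to be added when it lies in the zero
    set of f. *)
Lemma constant_syzygy_concurrent d (f : S) (c : 'I_3 -> K) k :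
  (0 < d)%N -> f != 0 -> f \is d.-homog -> c k != 0 ->
  \sum_i (c i)%:MP * f^`M(i) = 0 -> concurrent_lines f.
Proof.
move=> d0 f0 hf ck Ec.
have [jk tk tj [kj [kt jt]]] := ord3_cycle_neq k.
pose j := k + 1; pose t := k + 2.
pose L i : S := 'X_i - (c i / c k)%:MP * 'X_k.
have LE i x : (L i).@[x] = x i - c i / c k * x k.
  by rewrite mevalB mevalM mevalC !mevalXU.
have Lhom i : L i \is 1.-homog.
  by rewrite rpredB ?dhomogCM // dhomogX /= mdeg1.
pose y x (i : 'I_3) := (L i).@[x].
have fy x : f.@[x] = f.@[y x].
  rewrite -(directional_const (y x) (x k / c k) Ec); apply: meval_eq => i.
  by rewrite /y LE; ring.
have yk x : y x k = 0 by rewrite /y LE divff // mul1r subrr.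
pose E (i' : 'I_3) (i : 'I_3) : K := (i == i')%:R.
pose G := line_poly (E t) (E j) f.
have GE x : y x t != 0 -> f.@[x] = y x t ^+ d * G.[y x j / y x t].
  move=> yt; rewrite horner_line_poly -meval_scale // fy; apply: meval_eq => i.
  rewrite /E; case: (ord3_cycle k i) => ->; rewrite ?kt ?kj ?jt ?tj ?eqxx.
  - by rewrite yk mulr0 addr0 mulr0.
  - by rewrite mulr1 add0r mulrC divfK.
  - by rewrite mulr0 addr0 mulr1.
have fy0 x : y x t = 0 -> f.@[x] = y x j ^+ d * f.@[E j].
  move=> yt; rewrite -meval_scale // fy; apply: meval_eq => i.
  rewrite /E; case: (ord3_cycle k i) => ->; rewrite ?kj ?tj ?eqxx ?mulr0 ?mulr1 //.
have LEt : (L t).@[E t] = 1 by rewrite LE /E eqxx kt mulr0 subr0.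
have Lt0 : L t != 0.
  by apply/eqP => Lt; move: LEt; rewrite Lt meval0 => /eqP; rewrite eq_sym oner_eq0.
have G0 : G != 0.
  have [x] : exists x, (f * L t).@[x] != 0 by apply: meval_nonzero; rewrite mulf_neq0.
  rewrite mevalM mulf_eq0 negb_or => /andP[fx yt]; apply/eqP => Gz.
  by rewrite (GE _ yt) Gz horner0 mulr0 eqxx in fx.
have [rs Grs] := closed_field_poly_normal G.
have Groot u : (G.[u] == 0) = has (fun z => u - z == 0) rs.
  rewrite Grs hornerZ mulf_eq0 lead_coef_eq0 (negbTE G0) /= -[LHS]/(root _ u).
  by rewrite root_prod_XsubC -has_pred1; apply: eq_has => z /=; rewrite subr_eq0 eq_sym.
(* If G has no root it is a constant g0; by homogeneity f is then g0 y_t^d, which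
   vanishes at the point with y_t = 0.  This keeps the list of lines nonempty,
   as it must be at q = c. *)
have rs_nil : rs = [::] -> f.@[E j] = 0.
  move=> rs0; pose H := line_poly (E j) (E t) f.
  pose g0 := lead_coef G.
  have Gc : G = g0%:P by rewrite Grs rs0 big_nil alg_polyC.
  have HE : H = g0 *: 'X^d.
    apply/eqP; rewrite -subr_eq0; apply/negbNE/negP => HX.
    (* the factor 'X provides a point with y_t != 0, where G computes f *)
    have [|s] := @poly_nonroot _ ('X * (H - g0 *: 'X^d)).
      by rewrite mulf_neq0 // polyX_eq0.
    rewrite hornerM hornerX mulf_eq0 negb_or => /andP[s0 /negP]; apply.
    rewrite hornerD hornerN hornerZ hornerXn horner_line_poly subr_eq0.
    have yE : y (fun i => E j i + s * E t i) t = s.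
      by rewrite /y LE /E tj kj kt !eqxx !(mulr1, mulr0, add0r, subr0).
    by rewrite GE yE // Gc hornerC mulrC.
  have := congr1 (fun r : {poly K} => r.[0]) HE.
  rewrite horner_line_poly hornerZ hornerXn expr0n (gtn_eqF d0) mulr0 => <-.
  by apply: meval_eq => i; rewrite mul0r addr0.
pose fc : {ffun 'I_3 -> K} := [ffun i => c i].
exists fc, ([seq L j - z%:MP * L t | z <- rs] ++ if f.@[E j] == 0 then [:: L t] else [::]).
have Lc i : (L i).@[fc] = 0 by rewrite LE !ffunE divfK // subrr.
have LEj z : (L j - z%:MP * L t).@[E j] = 1.
  by rewrite mevalB mevalM mevalC !LE /E eqxx kj tj !mulr0 !subr0 mulr0 subr0.
split.
- by apply/eqP => /ffunP/(_ k); rewrite !ffunE => /eqP; rewrite (negbTE ck).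
- move=> l; rewrite mem_cat => /orP[/mapP[z _ ->]|].
    split; last by rewrite mevalB mevalM !Lc mulr0 subr0.
      by apply/eqP => l0; have := LEj z; rewrite l0 meval0 => /eqP; rewrite eq_sym oner_eq0.
    by apply: rpredB; rewrite ?dhomogCM ?Lhom.
  by case: ifP => // _; rewrite inE => /eqP->; split.
move=> q _; rewrite has_cat has_map.
have hasE : has (preim (fun z => L j - z%:MP * L t) (fun l => l.@[q] == 0)) rs
    = has (fun z => y q j - z * y q t == 0) rs.
  by apply: eq_has => z /=; rewrite mevalB mevalM mevalC.
rewrite {}hasE; have [yt|yt] := eqVneq (y q t) 0.
  rewrite (fy0 _ yt) mulf_eq0 expf_eq0 d0 /= yt.
  under eq_has do rewrite mulr0 subr0.
  have [yj|yj] := eqVneq (y q j) 0; last first.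
    rewrite (_ : has _ rs = false) ?orFb /=; last first.
      by apply/negbTE/hasPn.
    by case: ifP => //= _; rewrite -/(y q t) yt eqxx.
  case: (rs) rs_nil => [r0|] //=.
  by rewrite r0 // eqxx /= -/(y q t) yt eqxx.
rewrite (GE _ yt) mulf_eq0 expf_eq0 (negbTE yt) andbF /= Groot.
rewrite [X in _ || X](_ : _ = false) ?orbF; last first.
  by case: ifP => //= _; rewrite -/(y q t) (negbTE yt).
apply: eq_has => z; rewrite -[RHS](mulrI_eq0 _ (lregP (invr_neq0 yt))).
by rewrite mulrBr mulrCA mulVf // mulr1 mulrC.
Qed.

End Concurrent.

(** * The Milnor algebra *)

Section Translation.
Variable K : fieldType.
Local Notation S := {mpoly K[3]}.
Implicit Types (f u : S).

Local Notation partials f := (fun i => f^`M(i)).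

Lemma mem_jacobian f u : (u \in jacobian f) <-> in_ideal3 (partials f) u.
Proof. by split=> [/asboolP|H]; last apply/asboolP. Qed.

Lemma in_saturationE f u : in_saturation f u <-> in_sat (partials f) u.
Proof.
split=> [[k Hk]|[k Hk]]; exists k.
  move=> g /dhomogP hg; rewrite [g]mpolyE mulr_suml big_seq.
  apply: (big_ind (in_ideal3 (partials f))) => [|*|m mg]; [exact: inJ0|exact: inJD|].
  by rewrite -mul_mpolyC -mulrA; apply/inJM/mem_jacobian/Hk/hg.
by move=> t ht; apply/mem_jacobian/Hk; rewrite dhomogX /= ht.
Qed.

Lemma milnor_pi_eq0 f u : milnor_pi f u = 0 <-> in_ideal3 (partials f) u.
Proof.
rewrite -(subrr (milnor_pi f u)) -milnor_piB subrr.
by split=> [/milnor_piP|Ju]; [|apply/milnor_piP]; rewrite subr0 mem_jacobian.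
Qed.

Lemma milnor_piZ f a u : milnor_pi f (a * u) = a *: milnor_pi f u.
Proof. by rewrite -milnor_scale_pi. Qed.

Lemma nearly_free_dim1 f k u v : nearly_free f -> u \is k.-homog ->
  v \is k.-homog -> in_sat (partials f) u -> in_sat (partials f) v ->
  ~ in_ideal3 (partials f) v ->
  exists c : K, in_ideal3 (partials f) (u - c%:MP * v).
Proof.
move=> [_ /(_ k)[b _ bP]] hu hv Iu Iv nJv.
have coef w : w \is k.-homog -> in_sat (partials f) w ->
    exists c : K, milnor_pi f w = c%:MP *: b ord0.
  move=> hw Iw; have [|c ->] := bP (milnor_pi f w).
    split; first by exists w => //; apply/in_saturationE.
    by exists w.
  by exists (c ord0); rewrite big_ord1.
have [cu Eu] := coef u hu Iu; have [cv Ev] := coef v hv Iv.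
have cv0 : cv != 0.
  apply/eqP => cv0; apply: nJv; apply/milnor_pi_eq0.
  by rewrite Ev cv0 mpolyC0 scale0r.
exists (cu / cv); apply/milnor_pi_eq0.
rewrite milnor_piB milnor_piZ Eu Ev scalerA.
by rewrite -rmorphM /= divfK // subrr.
Qed.

Lemma mderiv_homog d (f : S) i : f \is d.-homog -> f^`M(i) \is d.-1.-homog.
Proof.
move=> /dhomogP hf; apply/dhomogP => m; rewrite mcoeff_msupp mcoeff_mderiv => fm.
have /hf <- : (m + U_(i))%MM \in msupp f.
  by rewrite mcoeff_msupp; apply: contra fm => /eqP->; rewrite mul0rn.
by rewrite /= mdegD mdeg1 addn1.
Qed.

End Translation.

(** * Choosing coordinates adapted to N *)

Section Coordinates.
Variable K : fieldType.
Local Notation S := {mpoly K[3]}.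

(** The second hypothesis is a 2 x 2 minor of (p, q); being polynomial in p it can
    be imposed on p together with the nonvanishing of some f_i. *)
Lemma point_pair_basis (p q : 'I_3 -> K) (k : 'I_3) : q k != 0 ->
  q k * p (k + 1) - q (k + 1) * p k != 0 ->
  exists P : 'M[K]_3, [/\ P \in unitmx, P 1 =1 p & P 2 =1 q].
Proof.
move=> qk D.
have [jk tk tj [kj [kt jt]]] := ord3_cycle_neq k.
pose P : 'M[K]_3 := \matrix_(i, j)
  (if i == 0 then (j == k + 2)%:R else if i == 1 then p j else q j).
exists P; split=> [|i|i]; rewrite ?mxE //.
rewrite -row_free_unit; apply: inj_row_free => w wP.
have Ew j : w 0 0 * (j == k + 2)%:R + w 0 1 * p j + w 0 2 * q j = 0.
  by move/rowP/(_ j): wP; rewrite mxE sum3E [RHS]mxE !mxE.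
have := Ew k; rewrite kt mulr0 add0r => Ek.
have := Ew (k + 1); rewrite jt mulr0 add0r => Ej.
have w1 : w 0 1 = 0.
  apply: (mulIf D); rewrite mul0r.
  transitivity (q k * (w 0 1 * p (k + 1) + w 0 2 * q (k + 1))
    - q (k + 1) * (w 0 1 * p k + w 0 2 * q k)); first by ring.
  by rewrite Ek Ej !mulr0 subrr.
have w2 : w 0 2 = 0.
  by apply: (mulIf qk); rewrite mul0r -Ek w1 mul0r add0r.
have w0 : w 0 0 = 0.
  by have := Ew (k + 2); rewrite eqxx w1 w2 !mul0r !addr0 mulr1.
by apply/rowP => i; rewrite [RHS]mxE; case: (ord3P i) => ->.
Qed.

(** N is graded and lives in nonnegative degrees. *)
Lemma least_saturated (f : 'I_3 -> S) e u : (forall i, f i \is e.-homog) ->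
  in_sat f u -> ~ in_ideal3 f u ->
  exists k h, [/\ h \is k.-homog, in_sat f h, ~ in_ideal3 f h &
    forall j v, (j < k)%N -> v \is j.-homog -> in_sat f v -> in_ideal3 f v].
Proof.
move=> hf Iu nJu.
pose Q k := `[< exists h, [/\ h \is k.-homog, in_sat f h & ~ in_ideal3 f h] >].
have exQ : exists k, Q k.
  apply: contrapT => H; apply: nJu.
  rewrite (pihomog_partitionE (leqnn (mmeasure mdeg u))).
  apply: (big_ind (in_ideal3 f)) => [|*|k _]; [exact: inJ0|exact: inJD|].
  apply: contrapT => nJ; apply: H; exists k; apply/asboolP.
  exists (pihomog mdeg k u).
  by split=> //; [apply: pihomogP|apply: in_sat_pihomog].
have [k /asboolP[h [hh Ih nJh]] kmin] := ex_minnP exQ.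
exists k, h; split=> // j v jk hv Iv; apply: contrapT => nJ.
suff : (k <= j)%N by rewrite leqNgt jk.
by apply: kmin; apply/asboolP; exists v.
Qed.

(** All 'X_i h are multiples q_i of one class 'X_i0 h modulo J, so that the linear
    form with coefficients c acts on h as its value at q. *)
Lemma annihilator_point (f : 'I_3 -> S) k h : h \is k.-homog -> in_sat f h ->
  (forall u v, u \is k.+1.-homog -> v \is k.+1.-homog -> in_sat f u -> in_sat f v ->
     ~ in_ideal3 f v -> exists c : K, in_ideal3 f (u - c%:MP * v)) ->
  exists (q : 'I_3 -> K) i, q i != 0 /\
    forall c : 'I_3 -> K, \sum_i c i * q i = 0 ->
    in_ideal3 f ((\sum_i (c i)%:MP * 'X_i) * h).
Proof.
move=> hh Ih dim1.
have [Jh|] := pselect (forall i, in_ideal3 f ('X_i * h)).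
  exists (fun=> 1), 0; split=> [|c _]; first exact: oner_neq0.
  rewrite mulr_suml; apply: (big_ind (in_ideal3 f)) => [|*|i _].
  - exact: inJ0.
  - exact: inJD.
  - by rewrite -mulrA; apply: inJM.
move=> /existsNP[i0 nJ].
have hX i : 'X_i * h \is k.+1.-homog.
  by rewrite -[k.+1]add1n; apply: dhomogM; rewrite ?dhomogX /= ?mdeg1.
have /fin_all_exists[q Hq] i : exists c : K, in_ideal3 f ('X_i * h - c%:MP * ('X_i0 * h)).
  by apply: dim1 => //; apply: in_satM.
exists q, i0; split.
  by apply/eqP => qi0; apply: nJ; have := Hq i0; rewrite qi0 mpolyC0 mul0r subr0.
move=> c cq.
rewrite (_ : _ * h = \sum_i (c i)%:MP * ('X_i * h - (q i)%:MP * ('X_i0 * h))).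
  apply: (big_ind (in_ideal3 f)) => [|*|i _]; [exact: inJ0|exact: inJD|].
  exact: inJM.
under [RHS]eq_bigr do rewrite mulrBr [X in _ - X]mulrA -rmorphM /=.
rewrite sumrB -mulr_suml -rmorph_sum cq rmorph0 mul0r subr0 mulr_suml.
by apply: eq_bigr => i _; rewrite mulrA.
Qed.

End Coordinates.

Section SyzygyBasis.
Variable K : numFieldType.
Local Notation S := {mpoly K[3]}.

(** The generators are renumbered by increasing degree. *)
Lemma syzygy_basis (f : 'I_3 -> S) e u : (forall i, f i \is e.-homog) -> (0 < e)%N ->
  (forall k u v, u \is k.-homog -> v \is k.-homog -> in_sat f u -> in_sat f v ->
     ~ in_ideal3 f v -> exists c : K, in_ideal3 f (u - c%:MP * v)) ->
  in_sat f u -> ~ in_ideal3 f u ->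
  (forall s, dot f s = 0 -> vhom 0 s -> s = 0) ->
  exists (a m : nat) (r : 'I_3 -> 'rV[S]_3) (g : 'I_3 -> S),
  [/\ [/\ vhom a.+1 (r 0), vhom (a + m).+1 (r 1) & vhom (a + m).+1 (r 2)],
      [/\ g 0 \is m.+1.-homog, g 1 \is 1.-homog, g 2 \is 1.-homog & g 0 != 0],
      (forall i, dot f (r i) = 0) /\ g 0 *: r 0 + g 1 *: r 1 + g 2 *: r 2 = 0,
      forall s, dot f s = 0 -> exists u : 'I_3 -> S,
        s = u 0 *: r 0 + u 1 *: r 1 + u 2 *: r 2
    & forall u : 'I_3 -> S, u 0 *: r 0 + u 1 *: r 1 + u 2 *: r 2 = 0 ->
        exists v, forall i, u i = v * g i].
Proof.
move=> hf e_gt0 dim1 Iu nJu no_const.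
have [eta [h [hh Ih nJh h_least]]] := least_saturated hf Iu nJu.
have [q [k [qk ann]]] := annihilator_point hh Ih (dim1 eta.+1).
have [i0 fi0] : exists i, f i != 0.
  apply: contrapT => H; have f0 i : f i = 0.
    by apply/eqP/negbNE/negP => fi; apply: H; exists i.
  have := no_const (const_mx 1); rewrite /dot => H1.
  have /rowP/(_ 0) : const_mx 1 = 0 :> 'rV[S]_3.
    apply: H1; first by rewrite big1 // => i _; rewrite f0 mulr0.
    by move=> i; rewrite mxE dhomog1.
  by rewrite !mxE => /eqP; rewrite oner_eq0.
(* p is off the base locus and different from q *)
have [p] : exists p, (f i0 * ((q k)%:MP * 'X_(k + 1) - (q (k + 1))%:MP * 'X_k)).@[p] != 0.
  apply: meval_nonzero; rewrite mulf_neq0 //; apply/eqP => E.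
  have /eqP := congr1 (meval (fun i => (i == k + 1)%:R)) E.
  have [_ _ _ [kj _]] := ord3_cycle_neq k.
  by rewrite meval0 mevalB !mevalM !mevalC !mevalXU eqxx kj mulr1 mulr0 subr0 (negbTE qk).
rewrite mevalM mevalB !mevalM !mevalC !mevalXU mulf_eq0 negb_or => /andP[fp D].
have [P [P_unit Pp Pq]] := point_pair_basis qk D.
have {}fp : (f i0).@[P 1] != 0 by rewrite (meval_eq _ Pp).
have Jl j : j != 2 -> in_ideal3 f (dual_form P j * h).
  move=> j2; apply: ann.
  have := congr1 (fun M : 'M[K]_3 => M 2 j) (mulmxV P_unit).
  rewrite !mxE eq_sym (negbTE j2) => E; rewrite -[RHS]E.
  by apply: eq_bigr => i _; rewrite -Pq mulrC.
have exm : exists m, `[< in_ideal3 f (dual_form P 2 ^+ m.+1 * h) >].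
  have [m Hm] := Ih; exists m; apply/asboolP; rewrite exprS -mulrA; apply: inJM.
  exact/Hm/dual_form_exp_homog.
have [m /asboolP JC m_min] := ex_minnP exm.
have h_chain i : (i <= m)%N -> ~ in_ideal3 f (dual_form P 2 ^+ i * h).
  case: i => [_|i im Ji]; first by rewrite expr0 mul1r.
  suff : (m <= i)%N by rewrite leqNgt im.
  by apply: m_min; apply/asboolP.
have hlh j i : dual_form P j ^+ i * h \is (i + eta).-homog.
  by apply: dhomogM => //; apply: dual_form_exp_homog.
(* Below degree e the ideal J is 0, so l 0 h in J forces e <= eta + 1. *)
have [e_eta|eta_e] := ltnP eta.+1 e.
  case: nJh; have := inJ_lt hf e_eta (hlh 0 1%N) (Jl 0 isT).
  move/eqP; rewrite mulf_eq0 (negbTE (dual_form_neq0 P_unit 0)) /= => /eqP->.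
  exact: inJ0.
have [a Ea] : exists a, eta.+1 = (e + a)%N by exists (eta.+1 - e)%N; rewrite subnKC.
have hl1 j : dual_form P j * h \is (e + a).-homog by rewrite -Ea; apply: (hlh j 1%N).
have [A hA EA] := inJ_homog hf (hl1 0) (Jl 0 isT).
have [B hB EB] := inJ_homog hf (hl1 1) (Jl 1 isT).
have hlm : dual_form P 2 ^+ m.+1 * h \is (e + (a + m)).-homog.
  by rewrite addnA -Ea addSn addnC -addSn.
have [C hC EC] := inJ_homog hf hlm JC.
have aeta : eta.+1 = (a + e)%N by rewrite addnC.
pose kos := koszul_syz P m A B C.
have k_syz i : dot f (kos i) = 0 := kos_syz (esym EA) (esym EB) (esym EC) i.
have [h0 h1 h2] := kos_homog P hA hB hC.
have gen := kos_generate hf e_gt0 P_unit fp dim1 hh Ih h_least h_chain hA hB hC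
  (esym EA) (esym EB) (esym EC) aeta no_const.
have rel := kos_relations hf e_gt0 P_unit fp dim1 hh Ih h_least h_chain hA hB hC
  (esym EA) (esym EB) (esym EC) aeta.
exists a, m, (fun i => if i == 0 then kos 2 else if i == 1 then kos 0 else kos 1),
  (fun i => if i == 0 then dual_form P 2 ^+ m.+1
            else if i == 1 then dual_form P 0 else dual_form P 1).
split=> /=.
- by [].
- by rewrite dual_form_exp_homog !dual_form_homog expf_neq0 ?dual_form_neq0.
- split=> [i|]; first by case: ifP => // _; case: ifP.
  by rewrite -addrA addrC (kos_rel P).
- move=> s /gen[u0 [u1 [u2 ->]]].
  by exists (fun i => if i == 0 then u2 else if i == 1 then u0 else u1) => /=; row_ring.
move=> w Ew; have [|v [E0 E1 E2]] := rel (w 1) (w 2) (w 0).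
  by rewrite -[RHS]Ew; row_ring.
by exists v => i; case: (ord3P i) => ->.
Qed.

End SyzygyBasis.

(** * Graded and minimal maps given by matrices *)

Section Irrelevant.
Variable K : fieldType.
Local Notation S := {mpoly K[3]}.

Lemma in_irrelevantD (u v : S) :
  in_irrelevant u -> in_irrelevant v -> in_irrelevant (u + v).
Proof. exact: inJD. Qed.

Lemma in_irrelevantM (c u : S) : in_irrelevant u -> in_irrelevant (c * u).
Proof. exact: inJM. Qed.

Lemma in_irrelevant_homog k (g : S) : g \is k.+1.-homog -> in_irrelevant g.
Proof.
move=> hg; have [a Ea] := comp_mpoly_congr [tuple (0 : K)%:MP * (0 : S) | i < 3] g.
exists a; move: Ea; rewrite (@comp_mpoly_line _ _ _ _ (fun=> 0) _ hg).
rewrite expr0n mulr0 subr0 => {1}->; apply: eq_bigr => i _.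
by rewrite tnth_mktuple mulr0 subr0.
Qed.

Lemma zhomog0 k : zhomog k (0 : S).
Proof. by case: k => k /=; rewrite ?rpred0 ?eqxx. Qed.

Lemma zhomogD k (u v : S) : zhomog k u -> zhomog k v -> zhomog k (u + v).
Proof.
case: k => k /=; first exact: rpredD.
by move=> /eqP-> /eqP->; rewrite addr0.
Qed.

Lemma zhomogM k n (u g : S) : zhomog k u -> g \is n.-homog ->
  zhomog (k + n%:Z) (u * g).
Proof.
case: k => k hu hg; first exact: (dhomogM hu hg).
by rewrite (eqP hu) mul0r; apply: zhomog0.
Qed.

Lemma graded_mulmxr a b (s : a.-tuple int) (t : b.-tuple int) (M : 'M[S]_(a, b)) :
  (forall i j, exists2 n, M i j \is n.-homog & tnth t j = tnth s i + n%:Z) ->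
  graded_map (free_deg s) (free_deg t) (mulmxr M).
Proof.
move=> HM k u hu j; rewrite /= mxE.
apply: (big_ind (zhomog _)) => [|*|i _]; [exact: zhomog0|exact: zhomogD|].
by have [n hM ->] := HM i j; rewrite addrAC; apply: zhomogM.
Qed.

Lemma minimal_mulmxr a b (M : 'M[S]_(a, b)) :
  (forall i j, in_irrelevant (M i j)) -> minimal_map (mulmxr M).
Proof.
move=> HM u j; rewrite /= mxE.
apply: (big_ind (@in_irrelevant K)) => [|*|i _].
- exact: inJ0.
- exact: in_irrelevantD.
- exact: in_irrelevantM.
Qed.

End Irrelevant.

(** * Assembling the resolution *)

Section Augmentation.
Variables (K : fieldType) (f : {mpoly K[3]}).

Definition milnor_eps (u : 'rV[{mpoly K[3]}]_1) : milnor f := milnor_pi f (u 0 0).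

Fact milnor_eps_linear : linear milnor_eps.
Proof. by move=> a u v; rewrite /milnor_eps !mxE milnor_piD milnor_piZ. Qed.

HB.instance Definition _ := GRing.isLinear.Build {mpoly K[3]} 'rV[{mpoly K[3]}]_1
  (milnor f) *:%R milnor_eps milnor_eps_linear.

End Augmentation.

Section Assembly.
Variable K : numClosedFieldType.
Local Notation S := {mpoly K[3]}.
Local Notation partials f := (fun i => f^`M(i)).

Lemma no_constant_syzygy d (f : S) s : (0 < d)%N -> f \is d.-homog -> f != 0 ->
  ~ concurrent_lines f -> dot (partials f) s = 0 -> vhom 0 s -> s = 0.
Proof.
move=> d0 hf f0 nconc s0 hs; apply: contrapT => sn0; apply: nconc.
pose c i := (s 0 i).@[fun=> 0].
have sE i : s 0 i = (c i)%:MP by apply: meval_dhomog0.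
have [k ck] : exists k, c k != 0.
  apply: contrapT => H; apply: sn0; apply/rowP => i; rewrite sE mxE.
  have [->|ci] := eqVneq (c i) 0; first by rewrite mpolyC0.
  by case: H; exists i.
apply: (constant_syzygy_concurrent d0 f0 hf ck).
by rewrite -[RHS]s0; apply: eq_bigr => i _; rewrite -sE.
Qed.

Lemma nearly_free_resolution d (f : S) : (0 < d)%N -> f \is d.-homog ->
  f != 0 -> ~ concurrent_lines f -> nearly_free f ->
  exists d1 d2 d3 b : int,
    [/\ 1 <= d1, d1 <= d2, d2 <= d3 &
      has_minimal_graded_free_resolution (M := milnor f) (@milnor_deg _ f)
        [tuple - b - 2 * (d%:Z - 1)]
        [tuple - d1 - (d%:Z - 1); - d2 - (d%:Z - 1); - d3 - (d%:Z - 1)]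
        [tuple - d%:Z + 1; - d%:Z + 1; - d%:Z + 1]
        [tuple 0]].
Proof.
move=> d_gt0 hf f0 nconc nf.
have hdf i : f^`M(i) \is d.-1.-homog by apply: mderiv_homog.
have no_const s : dot (partials f) s = 0 -> vhom 0 s -> s = 0.
  exact: (no_constant_syzygy d_gt0 hf f0 nconc).
have e_gt0 : (0 < d.-1)%N.
  (* Three constants are always linearly dependent. *)
  rewrite lt0n; apply/negP => /eqP e0.
  pose M : 'M[K]_(3, 1) := \col_i (f^`M(i)).@[fun=> 0].
  have : kermx M != 0.
    rewrite -mxrank_eq0 mxrank_ker -lt0n subn_gt0.
    exact: leq_ltn_trans (rank_leq_col M) _.
  move=> /rowV0Pn[c /sub_kermxP cM c0].
  have := no_const (map_mx (@mpolyC 3 K) c) => Hc.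
  case/eqP: c0; apply/rowP => i.
  have /rowP/(_ i) : map_mx (@mpolyC 3 K) c = 0.
    apply: Hc; last by move=> j; rewrite mxE dhomogC.
    transitivity (((c *m M) 0 0)%:MP : S); last by rewrite cM mxE mpolyC0.
    rewrite mxE rmorph_sum; apply: eq_bigr => j _.
    rewrite !mxE rmorphM /=; congr (_ * _); apply: meval_dhomog0.
    by have := hdf j; rewrite e0.
  by rewrite !mxE => /eqP; rewrite mpolyC_eq0 => /eqP.
have [[w [u Iu Ew] w0] _] := nf.
have nJu : ~ in_ideal3 (partials f) u by move=> /milnor_pi_eq0; rewrite -Ew.
have dim1 k g h : g \is k.-homog -> h \is k.-homog -> in_sat (partials f) g ->
    in_sat (partials f) h -> ~ in_ideal3 (partials f) h ->
    exists c : K, in_ideal3 (partials f) (g - c%:MP * h).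
  exact: nearly_free_dim1 nf.
have /in_saturationE {}Iu := Iu.
have [a [m [r [g [[hr0 hr1 hr2] [hg0 hg1 hg2 g00] [r_syz r_rel] gen rel]]]]] :=
  syzygy_basis hdf e_gt0 dim1 Iu nJu no_const.
pose M3 : 'M[S]_(1, 3) := \row_i g i.
pose M2 : 'M[S]_3 := \matrix_(i, j) r i 0 j.
pose M1 : 'M[S]_(3, 1) := \col_i f^`M(i).
have M2E (v : 'rV[S]_3) : v *m M2 = v 0 0 *: r 0 + v 0 1 *: r 1 + v 0 2 *: r 2.
  apply/rowP => j; rewrite mxE sum3E ![M2 _ _]mxE.
  have rZ c i : (c *: r i) 0 j = c * r i 0 j := row_entryZ erefl c.
  exact: (esym (row_entryD (row_entryD (rZ _ _) (rZ _ _)) (rZ _ _))).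
have M3E (v : 'rV[S]_1) i : (v *m M3) 0 i = v 0 0 * g i.
  by rewrite mxE big_ord1 mxE.
have M1E (v : 'rV[S]_3) : v *m M1 = (dot (partials f) v)%:M.
  apply/rowP => j; rewrite !mxE ord1 mulr1n; apply: eq_bigr => i _.
  by rewrite mxE.
(* With e = d - 1, the syzygies live in S^3(-e), so the relation has degree
   a + m + 2 + e, which has to be b + 2 e. *)
exists a.+1%:Z, (a + m).+1%:Z, (a + m).+1%:Z, ((a + m).+2%:Z - d.-1%:Z).
split; [lia|lia|lia|].
exists (mulmxr M3), (mulmxr M2), (mulmxr M1), (@milnor_eps K f).
split; split.
- apply: graded_mulmxr => i j; rewrite ord1 mxE !(tnth_nth 0).
  case: (ord3P j) => ->; [exists m.+1 => //|exists 1%N => //|exists 1%N => //] => /=; lia.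
- apply: graded_mulmxr => i j; rewrite mxE !(tnth_nth 0).
  have -> : [tuple - d%:Z + 1; - d%:Z + 1; - d%:Z + 1]`_j = - d%:Z + 1.
    by case: (ord3P j) => ->.
  case: (ord3P i) => -> /=; [exists a.+1 => //|exists (a + m).+1 => //|exists (a + m).+1 => //]; lia.
- apply: graded_mulmxr => i j; rewrite mxE !(tnth_nth 0) ord1; exists d.-1 => //.
  have -> : [tuple - d%:Z + 1; - d%:Z + 1; - d%:Z + 1]`_i = - d%:Z + 1.
    by case: (ord3P i) => ->.
  rewrite /=; lia.
- move=> k v hv; exists (v 0 0) => //.
  by have := hv 0; rewrite (tnth_nth 0) /= add0r.
- move=> v w' /rowP E; apply/rowP => i; rewrite ord1.
  apply: (mulIf g00); have := E 0; rewrite /= !mxE !big_ord1 !mxE.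
  by [].
- move=> v; split=> /= [|[w' ->]].
    rewrite M2E => /(rel (fun i => v 0 i))[c Ec].
    exists c%:M; apply/rowP => i; rewrite Ec !mxE big_ord1 !mxE.
    by rewrite mulr1n.
  by rewrite M2E !M3E -!scalerA -!scalerDr r_rel scaler0.
- move=> v; split=> /= [|[w' ->]].
    rewrite M1E => /(congr1 (fun M : 'M[S]_1 => M 0 0)); rewrite !mxE mulr1n.
    move=> /gen[c ->]; exists (\row_i c i).
    by rewrite M2E !mxE.
  rewrite M1E M2E !dotD !dotZ !r_syz !mulr0 !addr0.
  by apply/rowP => j; rewrite !mxE mul0rn.
- move=> v; split=> [/milnor_pi_eq0/inJP[c Ec]|[c ->]].
    by exists c; rewrite /= M1E -Ec; apply/rowP => j; rewrite ord1 mxE mulr1n.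
  apply/milnor_pi_eq0; rewrite /= M1E mxE mulr1n; exact: inJ_dot.
- move=> v; exists (repr (v : Quotient.quot (jacobian_closed f)))%:M.
  by rewrite /= /milnor_eps mxE mulr1n milnor_reprK.
- apply: minimal_mulmxr => i j; rewrite mxE.
  by case: (ord3P j) => ->; apply: in_irrelevant_homog; eauto.
- apply: minimal_mulmxr => i j; rewrite mxE.
  by case: (ord3P i) => ->; [apply: in_irrelevant_homog (hr0 _) |
    apply: in_irrelevant_homog (hr1 _) | apply: in_irrelevant_homog (hr2 _)].
- apply: minimal_mulmxr => i j; rewrite mxE.
  by apply: (@in_irrelevant_homog _ d.-2); rewrite prednK.
Qed.

End Assembly.

Lemma reduced_neq0 (K : fieldType) (f : {mpoly K[3]}) : reduced f -> f != 0.
Proof.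
move=> fr; apply/eqP => f0.
have [|c Ec] := fr 'X_0 0; first by rewrite mulr0.
have := congr1 (fun g : {mpoly K[3]} => g@_U_(0)) Ec.
rewrite mcoeffX eqxx mcoeffC mnm1_eq0 mulr0 => /eqP.
by rewrite oner_eq0.
Qed.

Theorem theorem2p2 (R : realType) (d : nat) (f : {mpoly R[i]%C[3]})
    (d_gt0 : (0 < d)%N) (f_homog : f \is d.-homog) (f_reduced : reduced f)
    (f_nonconc : ~ concurrent_lines f) (f_nf : nearly_free f) :
  exists d1 d2 d3 b : int,
    [/\ 1 <= d1, d1 <= d2, d2 <= d3 &
      has_minimal_graded_free_resolution (M := milnor f) (@milnor_deg _ f)
        [tuple - b - 2 * (d%:Z - 1)]
        [tuple - d1 - (d%:Z - 1); - d2 - (d%:Z - 1); - d3 - (d%:Z - 1)]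
        [tuple - d%:Z + 1; - d%:Z + 1; - d%:Z + 1]
        [tuple 0]].
Proof.
exact: (@nearly_free_resolution R[i]%C d f d_gt0 f_homog (reduced_neq0 f_reduced)).
Qed.
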